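(* In the flat-interface setting of the context, for every $x'$ the projected germ $\mathcal G_{\mathrm{vv}}(x')$ is maximal $L^1$-dissipative for the reduced normal fluxes $\widehat\Phi_-(x',\cdot)$ and $\widehat\Phi_+(x',\cdot)$. In particular, every $(r^-,r^+)\in\mathcal G_{\mathrm{vv}}(x')$ satisfies $$\widehat\Phi_-(x',r^-)=\widehat\Phi_+(x',r^+),$$ and for all pairs $(r^-,r^+),(s^-,s^+)\in\mathcal G_{\mathrm{vv}}(x')$, $$Q_+(x';r^+,s^+)-Q_-(x';r^-,s^-)\le0.$$
   Context: Let $d\ge1$, $x=(x_1,x')\in\mathbb R\times\mathbb R^{d-1}$, $\Omega_-=\{x_1<0\}$, $\Omega_+=\{x_1>0\}$, $a>0$, $K=[-a,a]$. Let $f\in C^2(\overline{\Omega_-}\times K;\mathbb R^d)$, $g\in C^2(\overline{\Omega_+}\times K;\mathbb R^d)$ with $f(x,\pm a)=0$ and $g(x,\pm a)=0$. The boundary normal fluxes are $\Phi_-(x',\lambda)=f_1(0^-,x',\lambda)$, $\Phi_+(x',\lambda)=g_1(0^+,x',\lambda)$; the boundary quotients are $P_\pm(x',\lambda)=\int_{-a}^\lambda|\partial_s\Phi_\pm(x',s)|^2ds$; the reduced fluxes $\widehat\Phi_\pm(x',\cdot):P_\pm(x',K)\to\mathbb R$ are the unique continuous functions with $\Phi_\pm(x',\lambda)=\widehat\Phi_\pm(x',P_\pm(x',\lambda))$. For $r,s\in P_\pm(x',K)$ put $Q_\pm(x';r,s)=\operatorname{sgn}(r-s)(\widehat\Phi_\pm(x',r)-\widehat\Phi_\pm(x',s))$.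 **$L^1$-dissipativity.** For continuous fluxes $\phi_\pm$ on intervals $I_\pm$, with $q_\pm(r,s)=\operatorname{sgn}(r-s)(\phi_\pm(r)-\phi_\pm(s))$, a set $\mathcal G\subset I_-\times I_+$ is an $L^1$-dissipative germ if $\phi_-(r^-)=\phi_+(r^+)$ for all $(r^-,r^+)\in\mathcal G$ and $q_+(r^+,s^+)-q_-(r^-,s^-)\le0$ for all $(r^-,r^+),(s^-,s^+)\in\mathcal G$. It is maximal if it has no proper $L^1$-dissipative extension, i.e. every pair in $I_-\times I_+$ that satisfies $\phi_-(r^-)=\phi_+(r^+)$ and the inequality against every element of $\mathcal G$ belongs to $\mathcal G$. **Vanishing-viscosity germ.** Let $\phi_-,\phi_+\in C^1(K)$. An elementary standing-wave pair is $(p^-,p^+)\in K^2$ for which there exist $s\in\mathbb R$ and a continuous $W:\mathbb R\to K$, $C^1$ on $(-\infty,0]$ and on $[0,\infty)$, with $W'=\phi_-(W)-s$ on $(-\infty,0]$, $W'=\phi_+(W)-s$ on $[0,\infty)$ (one-sided derivatives at $0$) and $W(\pm\infty)=p^\pm$. The physical vanishing-viscosity germ is the maximal $L^1$-dissipative germ generated by these pairs: the set of all $(q^-,q^+)\in K^2$ with $\phi_-(q^-)=\phi_+(q^+)$ and $\operatorname{sgn}(q^+-p^+)(\phi_+(q^+)-\phi_+(p^+))-\operatorname{sgn}(q^--p^-)(\phi_-(q^-)-\phi_-(p^-))\le0$ for every elementary standing-wave pair. $\mathcal G^{\mathrm{phys}}_{\mathrm{VV}}(x')$ denotes this germ for $\phi_\pm=\Phi_\pm(x',\cdot)$;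 it is known from the theory of $L^1$-dissipative germs that it is a maximal $L^1$-dissipative germ for $\Phi_\pm(x',\cdot)$. The projected germ is $$\mathcal G_{\mathrm{vv}}(x')=\{(P_-(x',p^-),P_+(x',p^+)):(p^-,p^+)\in\mathcal G^{\mathrm{phys}}_{\mathrm{VV}}(x')\}.$$ *)

(* Defs.v *)
From HB Require Import structures.
From mathcomp Require Import all_boot all_order all_algebra.
From mathcomp Require Import all_classical all_reals all_analysis.

Set Implicit Arguments.
Unset Strict Implicit.
Unset Printing Implicit Defensive.

Import Order.TTheory GRing.Theory Num.Theory.
Import numFieldNormedType.Exports.

Local Open Scope classical_set_scope.
Local Open Scope ring_scope.

(** ** Functions of class C^k up to the boundary *)

(* [Ck_closure k U e h] with U open: h is C^k on the closure of U, i.e. h and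
   all its partial derivatives of order <= k along the directions e_i exist in
   U and extend continuously to the closure of U.  At boundary points dh is the
   continuous extension of the derivative. *)
Fixpoint Ck_closure (R : realType) (V W : normedModType R) (k : nat)
    (U : set V) (I : Type) (e : I -> V) (h : V -> W) : Prop :=
  {within closure U, continuous h} /\
  if k is k'.+1 then
    forall i, exists dh : V -> W,
      (forall z, U z -> is_derive z (e i) h (dh z)) /\ Ck_closure k' U e dh
  else True.

(* Canonical basis of R^d x R; here and below d = n.+1. *)
Definition coord_dir (R : realType) (n : nat) (i : option 'I_n.+1) :
    ('rV[R]_n.+1 * R)%type :=
  if i is Some j then (delta_mx 0 j, 0) else (0, 1).

Definition Omega_minus (R : realType) (n : nat) : set 'rV[R]_n.+1 :=
  [set x | x 0 0 < 0].
Definition Omega_plus (R : realType) (n : nat) : set 'rV[R]_n.+1 :=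
  [set x | 0 < x 0 0].

Definition K (R : realType) (a : R) : set R := `[- a, a].

(* C^2(closure Omega x K; R^d), as closure (Omega x ]-a, a[) =
   closure Omega x K. *)
Definition flux_C2 (R : realType) (n : nat) (Omega : set 'rV[R]_n.+1) (a : R)
    (f : 'rV[R]_n.+1 * R -> 'rV[R]_n.+1) : Prop :=
  Ck_closure 2 (Omega `*` `]- a, a[) (@coord_dir R n) f.

(* The interface point (0, x'), with x' in R^(d-1), and the first component of
   the flux there: since f is continuous up to the interface, this value is the
   one-sided trace f_1(0^-, x', lambda), resp. f_1(0^+, x', lambda). *)
Definition interface_point (R : realType) (n : nat) (x' : 'rV[R]_n) :
    'rV[R]_n.+1 := row_mx (0 : 'rV[R]_1) x'.

Definition normal_flux (R : realType) (n : nat)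
    (f : 'rV[R]_n.+1 * R -> 'rV[R]_n.+1) (x' : 'rV[R]_n) (lambda : R) : R :=
  f (interface_point x', lambda) 0 0.

(** ** Boundary quotient and reduced flux of a scalar flux on K *)

(* The derivative is only relevant on ]-a, lambda[ : the endpoints are
   Lebesgue-null. *)
Definition quotient (R : realType) (a : R) (phi : R -> R) (lambda : R) : R :=
  \int[lebesgue_measure]_(s in `[- a, lambda]) (`|derive1 phi s| ^+ 2).

Definition is_reduced_flux (R : realType) (a : R) (phi phihat : R -> R) : Prop :=
  {within quotient a phi @` K a, continuous phihat} /\
  forall lambda, K a lambda -> phi lambda = phihat (quotient a phi lambda).

(* Definite description; [is_reduced_flux] determines phihat on
   [quotient a phi @` K a], the only place where it is evaluated below. *)
Definition reduced_flux (R : realType) (a : R) (phi : R -> R) : R -> R :=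
  xget (fun=> 0) [set phihat | is_reduced_flux a phi phihat].

(** ** L^1-dissipative germs *)

Definition kruzkov_flux (R : realType) (phi : R -> R) (r s : R) : R :=
  Num.sg (r - s) * (phi r - phi s).

Definition L1_dissipative (R : realType) (Im Ip : set R) (phim phip : R -> R)
    (G : set (R * R)) : Prop :=
  [/\ G `<=` Im `*` Ip,
      forall r, G r -> phim r.1 = phip r.2
    & forall r s, G r -> G s ->
        kruzkov_flux phip r.2 s.2 - kruzkov_flux phim r.1 s.1 <= 0].

Definition maximal_L1_dissipative (R : realType) (Im Ip : set R)
    (phim phip : R -> R) (G : set (R * R)) : Prop :=
  L1_dissipative Im Ip phim phip G /\
  forall r, (Im `*` Ip) r -> phim r.1 = phip r.2 ->
    (forall s, G s ->
       kruzkov_flux phip r.2 s.2 - kruzkov_flux phim r.1 s.1 <= 0) ->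
    G r.

Lemma kruzkov_fluxC (R : realType) (phi : R -> R) (r s : R) :
  kruzkov_flux phi r s = kruzkov_flux phi s r.
Proof. by rewrite /kruzkov_flux -(opprB s r) sgrN mulNr -mulrN opprB. Qed.

Lemma maximal_L1_dissipativeP (R : realType) (Im Ip : set R)
    (phim phip : R -> R) (G : set (R * R)) :
  maximal_L1_dissipative Im Ip phim phip G <->
  L1_dissipative Im Ip phim phip G /\
  forall G', L1_dissipative Im Ip phim phip G' -> G `<=` G' -> G' = G.
Proof.
split=> -[GD Gmax]; split=> //.
  move=> G' [GI' GRH' GD'] GG'; apply/seteqP; split=> // r G'r.
  by apply: Gmax; [exact: GI'|exact: GRH'|move=> s /GG'; exact: GD'].
move=> r rI rRH rG; case: GD => GI GRH GD.
rewrite -(Gmax (G `|` [set r])); [by right| |by left].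
split.
- by move=> s [/GI//|->].
- by move=> s [/GRH//|->].
- move=> s t [Gs|->] [Gt|->]; [exact: GD| |exact: rG|].
    by rewrite !(kruzkov_fluxC _ _ r.1) !(kruzkov_fluxC _ _ r.2) rG.
  by rewrite /kruzkov_flux !(subrr, mulr0).
Qed.

(** ** The vanishing-viscosity germ *)

(* Derivative relative to A: one-sided at an endpoint of an interval A. *)
Definition has_derivative_within (R : realType) (A : set R) (W : R -> R)
    (x l : R) : Prop :=
  (W y - W x) / (y - x) @[y --> within A x^'] --> l.

(* W is C^1 on A with derivative dW. *)
Definition C1_within (R : realType) (A : set R) (W dW : R -> R) : Prop :=
  (forall x, A x -> has_derivative_within A W x (dW x)) /\
  {within A, continuous dW}.

Definition standing_wave_pair (R : realType) (a : R) (phim phip : R -> R)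
    (p : R * R) : Prop :=
  (K a `*` K a) p /\
  exists (s : R) (W : R -> R),
    [/\ continuous W /\ (forall x, K a (W x)),
        C1_within `]-oo, 0] W (fun x => phim (W x) - s),
        C1_within `[0, +oo[ W (fun x => phip (W x) - s),
        W x @[x --> -oo] --> p.1
      & W x @[x --> +oo] --> p.2].

Definition vv_germ (R : realType) (a : R) (phim phip : R -> R) :
    set (R * R) :=
  [set q | [/\ (K a `*` K a) q, phim q.1 = phip q.2
    & forall p, standing_wave_pair a phim phip p ->
        kruzkov_flux phip q.2 p.2 - kruzkov_flux phim q.1 p.1 <= 0]].

Definition projected_vv_germ (R : realType) (a : R) (phim phip : R -> R) :
    set (R * R) :=
  [set (quotient a phim p.1, quotient a phip p.2) | p in vv_germ a phim phip].

(* Main.v *)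
Require Import Defs.
From mathcomp Require Import all_boot all_order all_algebra.
From mathcomp Require Import all_classical all_reals all_analysis.
From mathcomp Require Import measurable_realfun ring lra.

Import Order.TTheory GRing.Theory Num.Theory.
Import numFieldNormedType.Exports.

Local Open Scope classical_set_scope.
Local Open Scope ring_scope.

Set Implicit Arguments.
Unset Strict Implicit.
Unset Printing Implicit Defensive.

(** The proof has two independent halves: the vanishing-viscosity germ is
maximal L^1-dissipative for the physical fluxes, and this property survives
the change of unknown given by the boundary quotients.

_The germ._ Write f, g for the fluxes on the left and on the right.  Call a
pair q with f q.1 = g q.2 = s connected when, for q.1 <= q.2, some c between
q.1 and q.2 has f >= s on [q.1, c] and g >= s on [c, q.2], and when the
mirror condition, with the inequalities reversed, holds for q.2 <= q.1.
Three facts carry the argument.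
- Standing waves join connected pairs ([standing_wave_connected]).  A
  trajectory of an autonomous scalar equation that goes from one value to
  another crosses each intermediate value in the direction of travel, so the
  right-hand side has the sign of the travel there; c is W 0, projected onto
  the segment of the end states.
- Any two connected pairs satisfy the dissipation inequality
  ([connected_dissipative]).  It could only fail if the pair with the
  higher flux level had its left state below and its right state above those
  of the other pair, and then the two sign conditions would contradict each
  other at some point ([connected_order]).
- A pair that is not connected violates the inequality against some standing
  wave ([exists_violating_wave]).  If q.1 <= q.2 and q is not connected, then
  f falls below s at some u and g falls below s at some v >= u; at a level s'
  slightly below s one finds a wave whose end states lie strictly inside.
  Such a wave is constant, or constant on one side of the interface and
  monotone on the other.  The monotone half is built by inverting the time
  map, the integral of 1 / (f - s') or 1 / (g - s'), which diverges at the
  end state because the flux is Lipschitz ([half_wave_up]).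
Hence the germ, the set of pairs compatible with all standing waves, consists
of connected pairs, is dissipative, and contains the standing waves; anything
compatible with the germ is then compatible with the standing waves and
belongs to it ([vv_germ_maximal]).

_The quotient._ Let P be the boundary quotient of a flux phi.  It is
nondecreasing, and Young's inequality applied to phi' gives
|phi y - phi x| <= e |y - x| + |P y - P x| / (4 e) for all e > 0
([flux_quotient_modulus]).  So phi factors through P by a continuous reduced
flux ([reduced_fluxP]), and sgn (P x - P y) = sgn (x - y) unless
P x = P y, in which case phi x = phi y.  Kruzhkov fluxes are therefore
preserved by P, and so is maximality ([maximal_L1_dissipative_image]).

Both halves rest on the normal fluxes being C^1 on K, a regularity that passes
from the open half-spaces to the interface ([C1_segment_trace]). *)

(** * Zeros and primitives of continuous functions *)

Lemma continuous_at_ball (R : realType) (h : R -> R) (x e : R) :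
  {for x, continuous h} -> 0 < e ->
  exists2 d, 0 < d & forall y, `|x - y| < d -> `|h x - h y| < e.
Proof.
move=> /cvgrPdist_lt hx e0; have /nbhs_ballP[d /= d0 dP] := hx _ e0.
by exists d => // y xy; apply: dP; rewrite /ball/=.
Qed.

Lemma lipschitz_continuous (R : realType) (L : R) (f : R -> R) :
  0 < L -> (forall u v, `|f u - f v| <= L * `|u - v|) -> continuous f.
Proof.
move=> L0 lf x; apply/cvgrPdist_lt => e e0.
apply/nbhs_ballP; exists (e / L); first by rewrite /= divr_gt0.
by move=> y; rewrite /ball/= ltr_pdivlMr// mulrC; apply: le_lt_trans; exact: lf.
Qed.

Lemma first_zero (R : realType) (h : R -> R) (m M : R) :
  continuous h -> m < M -> 0 < h m -> h M <= 0 ->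
  exists z, [/\ m < z <= M, h z = 0 & forall y, m <= y < z -> 0 < h y].
Proof.
move=> ch mM hm hM; pose S := [set x | m <= x <= M /\ h x <= 0].
have SM : S M by split=> //; rewrite lexx ltW.
have lS : has_lbound S by exists m => x [/andP[]].
have iS : has_inf S by split => //; exists M.
set z := inf S.
have zM : z <= M by exact: ge_inf.
have mz : m <= z by apply: lb_le_inf; [exists M|move=> x [/andP[]]].
have hz : h z <= 0.
  rewrite leNgt; apply/negP => hz.
  have [d d0 dP] := continuous_at_ball (ch z) hz.
  have [x Sx xz] := inf_adherent d0 iS.
  have zx : z <= x by exact: ge_inf.
  have /dP : `|z - x| < d by rewrite ler0_norm; [rewrite -/z in xz *; lra|lra].
  by case: Sx => _ hx; rewrite ltr_norml => /andP[_]; lra.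
have mz' : m < z.
  by rewrite lt_neqAle mz andbT; apply: contraTneq hm => ->; rewrite -leNgt.
have pos y : m <= y < z -> 0 < h y.
  move=> /andP[my yz]; rewrite ltNge; apply/negP => hy.
  have : z <= y by apply: ge_inf => //; split=> //; rewrite my; lra.
  by rewrite leNgt yz.
exists z; split; rewrite ?mz'//.
apply/eqP; rewrite eq_le hz leNgt; apply/negP => hz0.
have [||y] := @IVT _ h m z 0 mz; first exact: continuous_subspaceT.
  by rewrite ge_min le_max hz (ltW hm) orbT.
rewrite in_itv/= => /andP[my yz] hy.
have yz' : y < z.
  by rewrite lt_neqAle yz andbT; apply: contra_eq_neq hy => ->; lra.
by have := pos y; rewrite my yz' hy ltxx => /(_ isT).
Qed.

Lemma last_zero (R : realType) (h : R -> R) (m M : R) :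
  continuous h -> m < M -> h m <= 0 -> 0 < h M ->
  exists z, [/\ m <= z < M, h z = 0 & forall y, z < y <= M -> 0 < h y].
Proof.
move=> ch mM hm hM.
have [||||z [zM hz pos]] := @first_zero _ (h \o -%R) (- M) (- m).
- by move=> x; apply: continuous_comp; [exact: continuousN|exact: ch].
- by rewrite ltrN2.
- by rewrite /= opprK.
- by rewrite /= opprK.
exists (- z); split=> //; first by lra.
by move=> y yz; have := pos (- y); rewrite /= opprK; apply; lra.
Qed.

Lemma is_derive_integral (R : realType) (k : R -> R) (b x u : R) :
  b < x -> x < u -> (forall y, b <= y <= u -> {for y, continuous k}) ->
  is_derive x 1 (fun x => \int[lebesgue_measure]_(t in `[b, x]) k t) (k x).
Proof.
move=> bx xu ck.
have ik : (@lebesgue_measure R).-integrable `[b, u] (EFin \o k).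
  apply: continuous_compact_integrable; first exact: segment_compact.
  apply: continuous_in_subspaceT => y; rewrite inE/= in_itv/=; exact: ck.
have [|d1 d2] := continuous_FTC1_closed xu ik bx; first by apply: ck; lra.
by apply: DeriveDef; [exact: d1|rewrite -derive1E; exact: d2].
Qed.

Lemma ge0_is_derive_le (R : realType) (F dF : R -> R) (b c x y : R) :
  b <= x -> x <= y -> y <= c -> {within `[b, c], continuous F} ->
  (forall z : R, b < z < c -> is_derive z 1 F (dF z)) ->
  (forall z : R, 0 <= dF z) -> F x <= F y.
Proof.
move=> bx xy yc cF dFz dF0; apply: (@ger0_derive1_ndecr _ F b c) => //.
- move=> z; rewrite in_itv/= => zbc.
  by have dz := dFz _ zbc; exact: ex_derive.
- move=> z; rewrite in_itv/= => zbc.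
  by have dz := dFz _ zbc; rewrite derive1E derive_val.
Qed.

(** * Derivatives relative to a set *)

Lemma has_derivative_withinP (R : realType) (A : set R) (W : R -> R) (x l : R) :
  has_derivative_within A W x l <->
  forall e, 0 < e -> exists2 d, 0 < d & forall y, A y -> y != x ->
    `|x - y| < d -> `|l - (W y - W x) / (y - x)| < e.
Proof.
split=> [/cvgrPdist_lt WP e e0|WP].
  have := WP _ e0; rewrite near_withinE => /nbhs_ballP[d /= d0 dP].
  by exists d => // y Ay yx xy; exact: dP.
apply/cvgrPdist_lt => e e0; have [d d0 dP] := WP _ e0.
rewrite near_withinE; apply/nbhs_ballP; exists d => //= y xy yx Ay; exact: dP.
Qed.

Lemma is_derive_has_derivative_within (R : realType) (W : R -> R) (x l : R) :
  is_derive x 1 W l <-> has_derivative_within setT W x l.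
Proof.
split.
- move=> [dW Wl]; apply/has_derivative_withinP => e e0.
  have : h^-1 *: ((W \o shift x) h - W x) @[h --> 0^'] --> l.
    rewrite -Wl /derive.
    rewrite (_ : (fun h => _) =
      (fun h : R => h^-1 *: ((W \o shift x) (h *: (1 : R)) - W x))).
      exact: dW.
    by apply/funext => h; rewrite /GRing.scale/= mulr1.
  move=> /cvgrPdist_lt/(_ _ e0)/nbhs_ballP[d /= d0 dP].
  exists d => // y _ yx xy; have := dP (y - x).
  rewrite /ball/= sub0r opprB => /(_ xy); rewrite subr_eq0 => /(_ yx).
  by rewrite subrK /GRing.scale/= mulrC.
- move=> /has_derivative_withinP WP.
  have H : h^-1 *: (W (h *: 1 + x) - W x) @[h --> 0^'] --> l.
    apply/cvgrPdist_lt => e /WP[d d0 dP].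
    apply/nbhs_ballP; exists d => //= h; rewrite /ball/= => hd h0.
    have := dP (h + x) I.
    rewrite -subr_eq0 addrK => /(_ h0).
    rewrite opprD addrCA subrr addr0 -[- h]add0r => /(_ hd).
    by rewrite /GRing.scale/= mulr1 mulrC.
  apply: DeriveDef; first by apply/cvg_ex; exists l.
  exact/cvg_lim.
Qed.

Lemma has_derivative_within_subset (R : realType) (A B : set R)
    (V W : R -> R) (x l : R) :
  A `<=` B -> A x -> {in A, V =1 W} ->
  has_derivative_within B W x l -> has_derivative_within A V x l.
Proof.
move=> AB Ax VW /has_derivative_withinP WP.
apply/has_derivative_withinP => e /WP[d d0 dP]; exists d => // y Ay yx xy.
by rewrite !VW ?inE//; apply: dP => //; exact: AB.
Qed.

Lemma has_derivative_within_interior (R : realType) (A : set R)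
    (W : R -> R) (x l d : R) :
  0 < d -> (forall y, `|x - y| < d -> A y) ->
  has_derivative_within A W x l -> is_derive x 1 W l.
Proof.
move=> d0 dA /has_derivative_withinP WP.
apply/is_derive_has_derivative_within/has_derivative_withinP => e /WP[c c0 cP].
exists (Num.min c d); first by rewrite lt_min c0.
by move=> y _ yx; rewrite lt_min => /andP[yc /dA Ay]; exact: cP.
Qed.

Lemma has_derivative_within_opp (R : realType) (A : set R) (W : R -> R)
    (x l : R) :
  has_derivative_within A W (- x) l ->
  has_derivative_within [set y | A (- y)] (W \o -%R) x (- l).
Proof.
move=> /has_derivative_withinP WP.
apply/has_derivative_withinP => e /WP[d d0 dP]; exists d => // y Ay yx xy.
have := dP (- y) Ay; rewrite eqr_opp yx => /(_ isT).
rewrite (_ : - x - - y = - (x - y)); last by ring.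
rewrite normrN => /(_ xy) /=.
rewrite (_ : - y - - x = - (y - x)); last by ring.
by rewrite invrN mulrN opprK -opprD normrN.
Qed.

(** * Monotone half-line trajectories *)

Section time_map.
Variables (R : realType) (h : R -> R) (m M L : R).
Hypotheses (ch : continuous h) (mM : m < M) (L0 : 0 < L).
Hypothesis h_gt0 : forall y, m <= y < M -> 0 < h y.
Hypothesis h_le : forall y, m <= y <= M -> h y <= L * (M - y).

(* Freezing h to the left of m lets the trajectory exist on both sides of the
   time 0, so that it has two-sided derivatives at all times t >= 0. *)
Let k x := h (Num.max m x).

Let k_gt0 x : x < M -> 0 < k x.
Proof. by move=> xM; apply: h_gt0; rewrite le_max lexx/= gt_max mM. Qed.

Let ck x : x < M -> {for x, continuous (fun y => (k y)^-1)}.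
Proof.
move=> xM; apply: continuousV; first by rewrite gt_eqF// k_gt0.
apply: (@continuous_comp _ _ _ (fun y => Num.max m y) h); last exact: ch.
apply: (@continuous_max _ _ (cst m) id); first exact: cst_continuous.
by move=> ?; exact: cvg_id.
Qed.

Let T x := \int[lebesgue_measure]_(t in `[m - 1, x]) (k t)^-1.

Let dT x : m - 1 < x < M -> is_derive x 1 T (k x)^-1.
Proof.
move=> /andP[mx xM]; apply: (@is_derive_integral _ _ _ _ ((x + M) / 2)) => //.
  lra.
by move=> y y1; apply: ck; lra.
Qed.

Let T_incr x y : m - 1 < x -> x < y -> y < M -> T x < T y.
Proof.
move=> mx xy yM.
have dT' z : z \in `]m - 1, M[ -> is_derive z 1 T (k z)^-1.
  by rewrite in_itv/=; exact: dT.
apply: (@gtr0_derive1_lt_oo _ T (m - 1) M); rewrite ?in_itv/= ?mx/=; try lra.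
- by move=> z /dT' dz; exact: ex_derive.
- move=> z zm; rewrite derive1E (@derive_val _ _ _ _ _ _ _ (dT' _ zm)).
  by rewrite invr_gt0 k_gt0//; move: zm; rewrite in_itv/= => /andP[].
- move=> z /set_mem /= zm; have dz := dT' _ zm.
  exact/differentiable_continuous/derivable1_diffP/ex_derive.
Qed.

(* The bound h y <= L (M - y) compares T with - L^-1 ln (M - w): the time map
   diverges at M, and the trajectory needs infinite time to reach M. *)
Let T_ge w : m <= w < M -> (ln (M - m) - ln (M - w)) / L <= T w - T m.
Proof.
move=> /andP[mw wM].
pose F x := T x + L^-1 * ln (M - x).
have dF z : m - 1 < z < M -> is_derive z 1 F ((k z)^-1 - (L * (M - z))^-1).
  move=> zm; have := dT zm => dTz; rewrite /F.
  have Mz : 0 < M - z by lra.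
  have dl := is_derive1_ln Mz.
  apply: is_derive_eq.
  rewrite invfM /GRing.scale/=. ring.
suff : F m <= F w by rewrite /F mulrBl !(mulrC _ L^-1); lra.
apply: (@ger0_derive1_ndecr _ F m w) => //.
- move=> z; rewrite in_itv/= => zm.
  have zm' : m - 1 < z < M by lra.
  have := dF _ zm' => dz; exact: ex_derive.
- move=> z; rewrite in_itv/= => zm.
  have zm' : m - 1 < z < M by lra.
  rewrite derive1E (@derive_val _ _ _ _ _ _ _ (dF _ zm')) subr_ge0.
  have kz : k z = h z by rewrite /k max_r//; lra.
  rewrite kz lef_pV2 ?posrE; first by apply: h_le; lra.
    by apply: mulr_gt0 => //; lra.
  by apply: h_gt0; lra.
- apply: derivable_within_continuous => z; rewrite in_itv/= => zm.
  have zm' : m - 1 < z < M by lra.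
  have := dF _ zm' => dz; exact: ex_derive.
Qed.

Let W t := xget m [set w | m - 1 < w < M /\ T w - T m = t].

Let WK w : m - 1 < w < M -> W (T w - T m) = w.
Proof.
move=> wm; rewrite /W; case: xgetP => [v _ [vm Tvw]|/(_ w)]; last first.
  by case; split.
have {}Tvw : T v = T w by exact: addIr Tvw.
case: (ltgtP v w) => // vw.
  have : T v < T w by apply: T_incr; lra.
  by rewrite Tvw ltxx.
have : T w < T v by apply: T_incr; lra.
by rewrite Tvw ltxx.
Qed.

Let T_surj t : 0 <= t -> exists2 w, m <= w < M & T w - T m = t.
Proof.
move=> t0; have Mm : 0 < M - m by rewrite subr_gt0.
have [w wE] : exists w, w = M - (M - m) * expR (- (L * t)) by eexists.
have e1 : 0 < expR (- (L * t)) <= 1.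
  by rewrite expR_gt0 -expR0 ler_expR oppr_le0 mulr_ge0// ltW.
have w1 : m <= w < M.
  have /andP[e2 e3] := e1.
  have := mulr_gt0 Mm e2; have := ler_wpM2l (ltW Mm) e3; rewrite wE; lra.
have Tw : t <= T w - T m.
  apply: le_trans (T_ge w1); rewrite {1}wE opprB addrCA subrr addr0.
  rewrite lnM ?posrE//; last by case/andP: e1.
  by rewrite expRK ler_pdivlMr//; lra.
have Tm : {within `[m, w], continuous T}.
  apply: derivable_within_continuous => z; rewrite in_itv/= => zm.
  have zm' : m - 1 < z < M by lra.
  have := dT zm' => dz; exact: ex_derive.
have [||c] := @IVT _ T m w (T m + t) _ Tm; first by lra.
  by rewrite ge_min le_max; apply/andP; split; apply/orP; [left|right]; lra.
rewrite in_itv/= => cm Tc; exists c; lra.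
Qed.

(** The inverse of the time map T solves W' = h W from m towards M. *)
Lemma half_wave_up : exists W : R -> R,
  [/\ W 0 = m, forall t : R, 0 <= t -> m <= W t < M,
      forall t : R, 0 <= t -> is_derive t 1 W (h (W t))
    & W x @[x --> +oo] --> M].
Proof.
have mM' : m < M by exact: mM.
have Wt t : 0 <= t -> m <= W t < M /\ T (W t) - T m = t.
  by move=> /T_surj[w wm <-]; rewrite WK//; lra.
exists W; split.
- have : W (T m - T m) = m by apply: WK; lra.
  by rewrite subrr.
- by move=> t /Wt[].
- move=> t /Wt[]; set w := W t => wm Twt.
  have wm' : m - 1 < w < M by lra.
  have dTw := dT wm'.
  pose S x := T x - T m.
  have dS : is_derive w 1 S (k w)^-1.
    by rewrite /S; apply: is_derive_eq; rewrite oppr0 addr0.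
  have near_w : \forall y \near w, m - 1 < y < M.
    have : \forall y \near w, y \in `]m - 1, M[.
      by apply: near_in_itvoo; rewrite in_itv/=.
    by apply: filterS => y; rewrite in_itv/=.
  have kw : k w = h w by rewrite /k max_r//; lra.
  have -> : h w = ((k w)^-1)^-1 by rewrite invrK kw.
  rewrite -Twt; apply: (@is_derive_inverse R S W (k w)^-1 w).
  + by apply: filterS near_w => y; exact: WK.
  + apply: filterS near_w => y /dT dy.
    apply: continuousB; last exact: cst_continuous.
    exact/differentiable_continuous/derivable1_diffP/ex_derive.
  + by rewrite invr_eq0 gt_eqF// k_gt0//; lra.
- apply/cvgrPdist_lt => e e0.
  pose v := Num.max m (M - e / 2).
  have vm : m <= v < M by rewrite /v le_max lexx/= gt_max mM/=; lra.
  have Mv : M - e < v by rewrite /v lt_max; apply/orP; right; lra.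
  near=> t.
  have tv : T v - T m < t by near: t; apply: nbhs_pinfty_gt; rewrite num_real.
  have [|Wm TW] := Wt t.
    by near: t; apply: nbhs_pinfty_ge; rewrite num_real.
  suff : v < W t by move=> ?; rewrite gtr0_norm; lra.
  rewrite ltNge; apply/negP; rewrite le_eqVlt => /predU1P[Wv|Wv].
    by move: tv; rewrite -TW Wv ltxx.
  have : T (W t) < T v by apply: T_incr; lra.
  lra.
Unshelve. all: by end_near. Qed.

End time_map.
(** The trajectory t |-> - W (- t), with W the half wave of y |-> h (- y). *)
Lemma half_wave_down (R : realType) (h : R -> R) (m M L : R) :
  continuous h -> m < M -> 0 < L -> (forall y, m < y <= M -> 0 < h y) ->
  (forall y, m <= y <= M -> h y <= L * (y - m)) ->
  exists V : R -> R,
  [/\ V 0 = M, forall t : R, t <= 0 -> m < V t <= M,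
      forall t : R, t <= 0 -> is_derive t 1 V (h (V t))
    & V x @[x --> -oo] --> m].
Proof.
move=> ch mM L0 h0 hL.
have [||||| W [W0 WM dW limW]] := @half_wave_up R (h \o -%R) (- M) (- m) L.
- by move=> x; apply: continuous_comp; [exact: continuousN|exact: ch].
- lra.
- exact: L0.
- by move=> y yM; apply: h0; lra.
- by move=> y yM; rewrite /= -[_ - y]addrC; apply: hL; lra.
exists (fun t => - W (- t)); split.
- by rewrite oppr0 W0 opprK.
- by move=> t t0; have := WM (- t); lra.
- move=> t t0; have t0' : 0 <= - t by lra.
  have := dW _ t0' => /is_derive_has_derivative_within.
  move=> /has_derivative_within_opp dWt.
  have dWN : is_derive t 1 (W \o -%R) (- h (- W (- t))).
    by apply/is_derive_has_derivative_within; exact: dWt.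
  rewrite -[h _]opprK.
  exact: (@is_deriveN _ _ _ (W \o -%R)).
- apply/cvgNy_compNP; rewrite -[m]opprK /comp/=.
  by under eq_fun do rewrite opprK; exact: cvgN.
Qed.

(** * Standing waves *)

Lemma standing_waveI (R : realType) (a s : R) (f g W : R -> R) (p : R * R) :
  continuous f -> continuous g -> (K a `*` K a) p ->
  continuous W -> (forall x, K a (W x)) ->
  (forall x, x <= 0 -> has_derivative_within `]-oo, 0] W x (f (W x) - s)) ->
  (forall x, 0 <= x -> has_derivative_within `[0, +oo[ W x (g (W x) - s)) ->
  W x @[x --> -oo] --> p.1 -> W x @[x --> +oo] --> p.2 ->
  standing_wave_pair a f g p.
Proof.
move=> cf cg Kp cW KW dWm dWp limm limp; split => //; exists s, W.
have cW' h : continuous h -> continuous (fun x => h (W x) - s).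
  move=> ch x; apply: continuousB; last exact: cst_continuous.
  by apply: continuous_comp; [exact: cW|exact: ch].
split => //; split.
- by move=> x; rewrite /= in_itv/=; exact: dWm.
- exact: continuous_subspaceT (cW' _ cf).
- by move=> x; rewrite /= in_itv/= andbT; exact: dWp.
- exact: continuous_subspaceT (cW' _ cg).
Qed.

(** Two trajectories that agree at the interface make a standing wave. *)
Lemma standing_wave_glue (R : realType) (a s : R) (f g V W : R -> R)
    (p : R * R) :
  continuous f -> continuous g -> (K a `*` K a) p -> V 0 = W 0 ->
  (forall x : R, x <= 0 -> K a (V x) /\ is_derive x 1 V (f (V x) - s)) ->
  (forall x : R, 0 <= x -> K a (W x) /\ is_derive x 1 W (g (W x) - s)) ->
  V x @[x --> -oo] --> p.1 -> W x @[x --> +oo] --> p.2 ->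
  standing_wave_pair a f g p.
Proof.
move=> cf cg Kp VW0 Vm Wp limm limp.
(* An expression valid on both half-lines, so that continuity at 0 needs no
   case analysis. *)
pose U (x : R) := V (Num.min x 0) + W (Num.max x 0) - V 0.
have UV x : x <= 0 -> U x = V x.
  by move=> x0; rewrite /U min_l// max_r// VW0 addrK.
have UW x : 0 <= x -> U x = W x.
  by move=> x0; rewrite /U min_r// max_l// addrAC subrr add0r.
apply: (@standing_waveI _ _ s _ _ U) => //.
- move=> x; rewrite /U.
  apply: cvgB; last exact: cvg_cst.
  apply: cvgD.
  + apply: (@continuous_comp _ _ _ (fun x : R => Num.min x 0) V).
      apply: (@continuous_min _ _ id (cst 0)); last exact: cst_continuous.
      by move=> ?; exact: cvg_id.
    have [|_ dV] := Vm (Num.min x 0); first by rewrite ge_min lexx orbT.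
    exact/differentiable_continuous/derivable1_diffP/ex_derive.
  + apply: (@continuous_comp _ _ _ (fun x : R => Num.max x 0) W).
      apply: (@continuous_max _ _ id (cst 0)); last exact: cst_continuous.
      by move=> ?; exact: cvg_id.
    have [|_ dW] := Wp (Num.max x 0); first by rewrite le_max lexx orbT.
    exact/differentiable_continuous/derivable1_diffP/ex_derive.
- move=> x; have [x0|/ltW x0] := leP x 0.
    by rewrite UV//; have [] := Vm _ x0.
  by rewrite UW//; have [] := Wp _ x0.
- move=> x x0; rewrite UV//.
  apply: (@has_derivative_within_subset _ _ setT _ V) => //.
  + by move=> y; rewrite inE/= in_itv/=; exact: UV.
  + by apply/is_derive_has_derivative_within; have [] := Vm _ x0.
- move=> x x0; rewrite UW//.
  apply: (@has_derivative_within_subset _ _ setT _ W) => //.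
  + by rewrite /= in_itv/= x0.
  + by move=> y; rewrite inE/= in_itv/= andbT; exact: UW.
  + by apply/is_derive_has_derivative_within; have [] := Wp _ x0.
- apply: cvg_trans limm; apply: near_eq_cvg.
  by near=> x; rewrite UV//; near: x; apply: nbhs_ninfty_le; rewrite num_real.
- apply: cvg_trans limp; apply: near_eq_cvg.
  by near=> x; rewrite UW//; near: x; apply: nbhs_pinfty_ge; rewrite num_real.
Unshelve. all: by end_near. Qed.

Lemma K_convex (R : realType) (a x y z : R) :
  K a x -> K a y -> x <= z <= y -> K a z.
Proof. by rewrite /K/= !in_itv/=; lra. Qed.

Lemma constant_wave (R : realType) (a : R) (f g : R -> R) (c : R) :
  continuous f -> continuous g -> K a c -> f c = g c ->
  standing_wave_pair a f g (c, c).
Proof.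
move=> cf cg Kc fgc.
apply: (@standing_wave_glue _ _ (g c) _ _ (cst c) (cst c)) => //.
- by move=> z _; split => //; rewrite /= fgc subrr; exact: is_derive_cst.
- by move=> z _; split => //; rewrite /= subrr; exact: is_derive_cst.
- exact: cvg_cst.
- exact: cvg_cst.
Qed.

Lemma wave_rising_right (R : realType) (a L s : R) (f g : R -> R) (m M : R) :
  0 < L -> (forall u v, `|g u - g v| <= L * `|u - v|) ->
  continuous f -> continuous g -> K a m -> K a M -> m < M ->
  f m = s -> g M = s -> (forall y, m <= y < M -> 0 < g y - s) ->
  standing_wave_pair a f g (m, M).
Proof.
move=> L0 lg cf cg Km KM mM fm gM g_gt.
have [||W [W0 WmM dW limW]] :=
  @half_wave_up R (fun t => g t - s) m M L _ mM L0 g_gt.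
- by move=> z; apply: continuousB; [exact: cg|exact: cst_continuous].
- move=> z zmM; have := lg z M.
  by rewrite ler_norml (ler0_norm (x := z - M)); lra.
apply: (@standing_wave_glue _ _ s _ _ (cst m) W) => //.
- move=> z _; split => //.
  by rewrite /= fm subrr; exact: is_derive_cst.
- move=> z z0; split; last exact: dW.
  have /andP[W1 W2] := WmM _ z0.
  by apply: (K_convex Km KM); rewrite W1 ltW.
- exact: cvg_cst.
Qed.

Lemma wave_rising_left (R : realType) (a L s : R) (f g : R -> R) (m M : R) :
  0 < L -> (forall u v, `|f u - f v| <= L * `|u - v|) ->
  continuous f -> continuous g -> K a m -> K a M -> m < M ->
  f m = s -> g M = s -> (forall y, m < y <= M -> 0 < f y - s) ->
  standing_wave_pair a f g (m, M).
Proof.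
move=> L0 lf cf cg Km KM mM fm gM f_gt.
have [||V [V0 VmM dV limV]] :=
  @half_wave_down R (fun t => f t - s) m M L _ mM L0 f_gt.
- by move=> z; apply: continuousB; [exact: cf|exact: cst_continuous].
- move=> z zmM; have := lf z m.
  by rewrite ler_norml (ger0_norm (x := z - m)); lra.
apply: (@standing_wave_glue _ _ s _ _ V (cst M)) => //.
- move=> z z0; split; last exact: dV.
  have /andP[V1 V2] := VmM _ z0.
  by apply: (K_convex Km KM); rewrite V2 ltW.
- move=> z _; split => //.
  by rewrite /= gM subrr; exact: is_derive_cst.
- exact: cvg_cst.
Qed.

(** Reversing time exchanges the two sides of the interface and changes the
sign of the fluxes; this reduces decreasing pairs to increasing ones. *)
Lemma standing_wave_reverse (R : realType) (a : R) (f g : R -> R) (x y : R) :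
  continuous f -> continuous g ->
  standing_wave_pair a (fun z => - g z) (fun z => - f z) (x, y) ->
  standing_wave_pair a f g (y, x).
Proof.
move=> cf cg [[Kx Ky] [s [W [[cW KW] [dWm _] [dWp _] limm limp]]]].
apply: (@standing_waveI _ _ (- s) _ _ (W \o -%R)) => //.
- by move=> z; apply: continuous_comp; [exact: continuousN|exact: cW].
- by move=> z; exact: KW.
- move=> z z0; have := dWp (- z); rewrite /= in_itv/= andbT oppr_ge0 => /(_ z0).
  move=> /has_derivative_within_opp.
  rewrite opprB opprK addrC opprK.
  rewrite (_ : [set y0 | _] = `]-oo, 0]%classic) //.
  by apply/seteqP; split=> t /=; rewrite !in_itv/= andbT oppr_ge0.
- move=> z z0; have := dWm (- z); rewrite /= in_itv/= oppr_le0 => /(_ z0).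
  move=> /has_derivative_within_opp.
  rewrite opprB opprK addrC opprK.
  rewrite (_ : [set y0 | _] = `[0, +oo[%classic) //.
  by apply/seteqP; split=> t /=; rewrite !in_itv/= andbT oppr_le0.
- by apply/cvgNy_compNP; rewrite /comp/=; under eq_fun do rewrite opprK.
- by move/cvgNy_compNP : limm.
Qed.

(** At its first passage through v > W 0 the trajectory comes from below, so its
velocity h v is nonnegative.  If h p were positive, the trajectory would leave
every neighbourhood of its limit p with a speed bounded below. *)
Lemma trajectory_direction_up (R : realType) (h W : R -> R) (p : R) :
  continuous h -> continuous W ->
  (forall t : R, 0 < t -> is_derive t 1 W (h (W t))) ->
  W x @[x --> +oo] --> p ->
  (forall v, W 0 < v < p -> 0 <= h v) /\ h p <= 0.
Proof.
move=> ch cW dW limW; split.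
  move=> v /andP[v0 vp]; rewrite leNgt; apply/negP => hv.
  have [T T0 TW] : exists2 T, 0 < T & v < W T.
    near (+oo : set_system R) => T; exists T.
      by near: T; apply: nbhs_pinfty_gt; rewrite num_real.
    near: T.
    have /cvgrPdist_lt/(_ (p - v)) := limW.
    rewrite subr_gt0 => /(_ vp); apply: filterS => T.
    rewrite ltr_norml; lra.
  have [|||z [z0 Wz zlt]] := @first_zero R (fun t => v - W t) 0 T _ T0.
  - by move=> x; apply: continuousB; [exact: cst_continuous|exact: cW].
  - lra.
  - lra.
  have z0' : 0 < z by lra.
  have := dW _ z0' => /is_derive_has_derivative_within/has_derivative_withinP.
  have Wzv : W z = v by lra.
  rewrite Wzv => /(_ (- h v)); rewrite oppr_gt0 => /(_ hv)[d d0 dP].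
  (* a time before z, close enough to z to see the sign of the derivative *)
  pose y := Num.max (z / 2) (z - d / 2).
  have y0 : z / 2 <= y by rewrite /y le_max lexx.
  have y1 : z - d / 2 <= y by rewrite /y le_max lexx orbT.
  have y2 : y < z by rewrite /y gt_max; lra.
  have := dP y I; rewrite lt_eqF// ger0_norm; last lra.
  move=> /(_ isT) H.
  have {H} : `|h v - (W y - v) / (y - z)| < - h v by apply: H; lra.
  rewrite ltr_norml => /andP[H _].
  have : (W y - v) / (y - z) < 0 by lra.
  have Wy : 0 < v - W y by apply: zlt; lra.
  rewrite ltNge => /negP; apply.
  rewrite -mulrNN -invrN mulr_ge0// ?invr_ge0; lra.
rewrite leNgt; apply/negP => hp.
have hp2 : 0 < h p / 2 by lra.
have [d d0 dP] := continuous_at_ball (ch p) hp2.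
have [T T0 TW] : exists2 T, 0 < T & forall t, T <= t -> `|p - W t| < d.
  have /cvgrPdist_lt/(_ _ d0)[A [_ AP]] := limW.
  exists (Num.max 1 (A + 1)); first by rewrite lt_max ltr01.
  by move=> t; rewrite ge_max => /andP[_ tA]; apply: AP; lra.
(* a time span over which a speed h p / 2 covers the diameter 2 d *)
pose N := 4 * d / h p.
have N0 : 0 < N by rewrite /N divr_gt0//; lra.
have TN : T < T + N by lra.
have [||c cT] := @MVT R W (fun t => h (W t)) _ _ TN.
- move=> x; rewrite in_itv/= => xT; apply: dW; lra.
- exact: continuous_subspaceT.
have {}cT : T < c < T + N by move: cT; rewrite in_itv.
have Wc : `|p - W c| < d by apply: TW; lra.
have := dP _ Wc; rewrite ltr_norml => hc.
have := TW T (lexx _); have := TW (T + N) (ltW TN).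
rewrite !ltr_norml => W1 W2 WW.
have : h p / 2 * N < h (W c) * N by rewrite ltr_pM2r//; lra.
rewrite {1}/N (_ : h p / 2 * _ = 2 * d); last by field; rewrite gt_eqF.
have : T + N - T = N by lra.
move=> TNT; move: WW; rewrite TNT => <-. lra.
Unshelve. all: by end_near. Qed.

Lemma trajectory_direction (R : realType) (h W : R -> R) (p : R) :
  continuous h -> continuous W ->
  (forall t : R, 0 < t -> is_derive t 1 W (h (W t))) ->
  W x @[x --> +oo] --> p ->
  [/\ h p = 0, forall v, W 0 < v < p -> 0 <= h v
    & forall v, p < v < W 0 -> h v <= 0].
Proof.
move=> ch cW dW limW.
have [up hp] := trajectory_direction_up ch cW dW limW.
have [|||| down hp'] := @trajectory_direction_up R
  (fun v => - h (- v)) (fun t => - W t) (- p).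
- move=> x; apply: continuousN.
  by apply: (@continuous_comp _ _ _ -%R h); [exact: continuousN|exact: ch].
- by move=> x; apply: continuousN; exact: cW.
- by move=> t t0; rewrite opprK; have := dW _ t0 => dWt; exact: is_deriveN.
- exact: cvgN.
split => //.
- by apply/eqP; rewrite eq_le hp/=; move: hp'; rewrite opprK oppr_le0.
- by move=> v v0; have := down (- v); rewrite opprK oppr_ge0; apply; lra.
Qed.

(** * Connected pairs *)

(** The sign condition that an increasing viscous profile from x to y, crossing
the interface at the value c, imposes on the fluxes at level s. *)
Definition connects_up (R : realType) (f g : R -> R) (s x y : R) : Prop :=
  exists c, [/\ x <= c <= y, forall z, x <= z <= c -> s <= f z
              & forall z, c <= z <= y -> s <= g z].

(** The last clause is the first one after time reversal, see
[standing_wave_reverse]: it reads f <= s and g <= s on the two segments. *)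
Definition connected (R : realType) (f g : R -> R) (q : R * R) : Prop :=
  [/\ f q.1 = g q.2,
      q.1 <= q.2 -> connects_up f g (f q.1) q.1 q.2
    & q.2 <= q.1 ->
        connects_up (fun z => - g z) (fun z => - f z) (- f q.1) q.2 q.1].

Lemma ge0_left_end (R : realType) (h : R -> R) (c y : R) :
  continuous h -> (forall z, c < z <= y -> 0 <= h z) -> c < y -> 0 <= h c.
Proof.
move=> ch h0 cy; rewrite leNgt; apply/negP => hc.
have [|||z [zc hz zlt]] := @first_zero R (fun t => - h t) c y _ cy.
- by move=> x; apply: continuousN; exact: ch.
- lra.
- by rewrite oppr_le0; apply: h0; lra.
have := zlt ((c + z) / 2); have := h0 ((c + z) / 2); lra.
Qed.

Lemma ge0_right_end (R : realType) (h : R -> R) (x c : R) :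
  continuous h -> (forall z, x <= z < c -> 0 <= h z) -> x < c -> 0 <= h c.
Proof.
move=> ch h0 xc; rewrite -[c]opprK.
apply: (@ge0_left_end _ (h \o -%R) _ (- x)); last lra.
  by move=> z; apply: continuous_comp; [exact: continuousN|exact: ch].
by move=> z zx; apply: h0; lra.
Qed.

(** The best candidate for c is the infimum of the points where f < s: beyond
it g >= s, for otherwise a point with g < s would follow one with f < s. *)
Lemma connects_upPn (R : realType) (f g : R -> R) (s x y : R) :
  continuous f -> continuous g -> x <= y -> s <= f x -> s <= g y ->
  ~ connects_up f g s x y ->
  exists u v, [/\ x <= u <= v, v <= y, f u < s & g v < s].
Proof.
move=> cf cg xy fx gy; apply: contra_notP => H.
have {}H u v : x <= u -> u <= v -> v <= y -> f u < s -> s <= g v.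
  move=> xu uv vy fu; rewrite leNgt; apply/negP => gv; apply: H.
  by exists u, v; split => //; rewrite xu.
pose S := [set u | x <= u <= y /\ f u < s].
have [fs|/existsNP[u0 /not_implyP[u0xy /negP]]] :=
    pselect (forall z, x <= z <= y -> s <= f z).
  exists y; split => //; first by rewrite xy lexx.
  by move=> z /le_anti <-.
rewrite -ltNge => fu0.
have Su0 : S u0 by [].
have iS : has_inf S by split; [exists u0|exists x => u [/andP[]]].
set c := inf S.
have xc : x <= c by apply: lb_le_inf; [exists u0|move=> u [/andP[]]].
have cu0 : c <= u0 by apply: ge_inf => //; case: iS.
have cy : c <= y by lra.
have fc z : x <= z < c -> s <= f z.
  move=> zc; rewrite leNgt; apply/negP => fz.
  suff : c <= z by lra.
  by apply: ge_inf; [case: iS|split => //; lra].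
have gc z : c < z <= y -> s <= g z.
  move=> cz; have zc0 : 0 < z - c by lra.
  have [u [uxy fu]] := inf_adherent zc0 iS; rewrite -/c => uz.
  by apply: (H u) => //; lra.
have cB (h : R -> R) : continuous h -> continuous (fun z => h z - s).
  by move=> ch z; apply: continuousB; [exact: ch|exact: cst_continuous].
have fcc : s <= f c.
  have [<-//|xc'] := eqVneq x c.
  rewrite -subr_ge0; apply: (@ge0_right_end _ (fun z => f z - s) x).
  - exact: cB.
  - by move=> z zc; rewrite subr_ge0; exact: fc.
  - by rewrite lt_neqAle xc'.
have gcc : s <= g c.
  have [->//|yc'] := eqVneq c y.
  rewrite -subr_ge0; apply: (@ge0_left_end _ (fun z => g z - s) _ y).
  - exact: cB.
  - by move=> z zc; rewrite subr_ge0; exact: gc.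
  - by rewrite lt_neqAle yc'.
exists c; split; first by rewrite xc.
- move=> z /andP[xz]; rewrite le_eqVlt => /predU1P[->//|zc].
  by apply: fc; rewrite xz.
- move=> z /andP[]; rewrite le_eqVlt => /predU1P[<-//|cz] zy.
  by apply: gc; rewrite cz.
Qed.

(** The value c at the interface need not lie between the end states x and y;
its projection onto [x, y] still separates the two sign conditions. *)
Lemma connects_up_trajectories (R : realType) (f g : R -> R) (s x c y : R) :
  f x = s -> g y = s -> continuous f -> continuous g ->
  (forall v, x < v < c -> s <= f v) -> (forall v, c < v < y -> s <= g v) ->
  x <= y -> connects_up f g s x y.
Proof.
move=> fx gy cf cg f1 g1 xy.
have cB (h : R -> R) : continuous h -> continuous (fun z => h z - s).
  by move=> ch z; apply: continuousB; [exact: ch|exact: cst_continuous].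
exists (Num.max x (Num.min c y)); split.
- by rewrite le_max lexx/= ge_max xy ge_min lexx orbT.
- move=> z /andP[]; rewrite le_eqVlt => /predU1P[<-|xz]; first by rewrite fx.
  rewrite le_max leNgt xz/= le_min => /andP[zc zy].
  move: zc; rewrite le_eqVlt => /predU1P[zc|zc]; last by apply: f1; rewrite xz.
  rewrite -subr_ge0.
  apply: (@ge0_right_end _ (fun z => f z - s) ((x + z) / 2)); last lra.
    exact: cB.
  by move=> w w1; rewrite subr_ge0; apply: f1; lra.
- move=> z; rewrite ge_max ge_min => /andP[/andP[xz czy]].
  rewrite le_eqVlt => /predU1P[->|zy]; first by rewrite gy.
  have cz : c <= z by case/orP: czy => //; lra.
  move: cz; rewrite le_eqVlt => /predU1P[cz|cz]; last by apply: g1; rewrite cz.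
  rewrite -subr_ge0.
  apply: (@ge0_left_end _ (fun z => g z - s) _ ((y + z) / 2)); last lra.
    exact: cB.
  by move=> w w1; rewrite subr_ge0; apply: g1; lra.
Qed.

Lemma standing_wave_connected (R : realType) (a : R) (f g : R -> R)
    (p : R * R) :
  continuous f -> continuous g ->
  standing_wave_pair a f g p -> connected f g p.
Proof.
move=> cf cg [_ [s [W [[cW KW] [dWm _] [dWp _] limm limp]]]].
have cN (h : R -> R) : continuous h -> continuous (fun z => - h z).
  by move=> ch z; apply: continuousN; exact: ch.
have cB (h : R -> R) t : continuous h -> continuous (fun z => h z - t).
  by move=> ch z; apply: continuousB; [exact: ch|exact: cst_continuous].
have [|||gp g1 g2] := @trajectory_direction _ (fun z => g z - s) W p.2 _ cW.
- exact: cB.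
- move=> t t0.
  apply: (@has_derivative_within_interior _ `[0, +oo[ _ _ _ t) => //.
    by move=> y; rewrite /= in_itv/= andbT ltr_norml; lra.
  by apply: dWp; rewrite /= in_itv/= andbT ltW.
- exact: limp.
have [||||fp f1 f2] := @trajectory_direction _
  (fun z => - (f z - s)) (W \o -%R) p.1.
- by apply: cN; exact: cB.
- by move=> z; apply: continuous_comp; [exact: continuousN|exact: cW].
- move=> t t0.
  apply: (@has_derivative_within_interior _
    [set y | `]-oo, 0]%classic (- y)] _ _ _ t) => //.
    by move=> y; rewrite /= in_itv/= ltr_norml; lra.
  by apply/has_derivative_within_opp/dWm; rewrite /= in_itv/=; lra.
- by move/cvgNy_compNP : limm.
have fps : f p.1 = s by lra.
have gps : g p.2 = s by lra.
rewrite /= oppr0 in f1 f2.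
split; first by rewrite fps.
- rewrite fps; apply: (@connects_up_trajectories _ _ _ _ _ (W 0)) => // v vW.
  + by have := f2 v vW; lra.
  + by have := g1 v vW; lra.
- rewrite fps; apply: (@connects_up_trajectories _ _ _ _ _ (W 0)) => //.
  + by rewrite gps.
  + by rewrite fps.
  + exact: cN.
  + exact: cN.
  + by move=> v vW; have := g2 v vW; lra.
  + by move=> v vW; have := f1 v vW; lra.
Qed.

(** Suppose that q has the higher level and q.1 < p.1, p.2 < q.2.  If q
increases, its switching value lies between p.2 and p.1, and there p, which
decreases, requires a flux at most f p.1 while q requires one at least f q.1.
If q decreases, q.1 or q.2 itself is such a point. *)
Lemma connected_order (R : realType) (f g : R -> R) (p q : R * R) :
  connected f g p -> connected f g q -> f p.1 < f q.1 ->
  q.1 < p.1 -> q.2 <= p.2.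
Proof.
move=> [pE _ pD] [qE qU _] pq q1p1; rewrite leNgt; apply/negP => p2q2.
have [qle|/ltW qge] := leP q.1 q.2.
  have [c [cq fc gc]] := qU qle.
  have cp1 : c < p.1.
    rewrite ltNge; apply/negP => p1c; have := fc p.1; lra.
  have p2c : p.2 < c.
    rewrite ltNge; apply/negP => p2c; have := gc p.2; lra.
  have p2p1 : p.2 <= p.1 by lra.
  have [d [dp gd fd]] := pD p2p1.
  have [cd|/ltW cd] := leP c d.
    have := gd c; have := gc c; lra.
  have := fd c; have := fc c; lra.
have p2p1 : p.2 <= p.1 by lra.
have [d [dp gd fd]] := pD p2p1.
have [q1d|/ltW q1d] := leP d q.1.
  have := fd q.1; lra.
have := gd q.2; lra.
Qed.

Lemma connected_dissipative (R : realType) (f g : R -> R) (p q : R * R) :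
  connected f g p -> connected f g q ->
  kruzkov_flux g q.2 p.2 - kruzkov_flux f q.1 p.1 <= 0.
Proof.
wlog : p q / f p.1 <= f q.1 => [wl|].
  have [pq|/ltW pq] := leP (f p.1) (f q.1); first exact: wl.
  by move=> Cp Cq; rewrite kruzkov_fluxC (kruzkov_fluxC f); exact: wl.
rewrite le_eqVlt => /predU1P[pq|pq] Cp Cq.
  case: (Cp) (Cq) => pE _ _ [qE _ _].
  by rewrite /kruzkov_flux -pE -qE pq subrr !mulr0 subrr.
have H := connected_order Cp Cq pq.
case: (Cp) (Cq) => pE _ _ [qE _ _].
rewrite /kruzkov_flux -pE -qE -mulrBl pmulr_lle0 ?subr_gt0// subr_le0.
have sg1 z : Num.sg z <= 1 :> R by case: sgrP => //; lra.
have [q1p1|q1p1|q1p1] := ltgtP q.1 p.1.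
- have q2p2 : q.2 < p.2.
    rewrite lt_neqAle H// andbT; apply: contraTneq pq => q2p2.
    by rewrite pE qE q2p2 ltxx.
  by rewrite !ltr0_sg// subr_lt0.
- by rewrite [leRHS]gtr0_sg ?subr_gt0.
- by move: pq; rewrite q1p1 ltxx.
Qed.

(** Since f falls below the level s at u and g falls below s at v >= u, some
level s' < s is attained by f at a point m in ]x, u[ and crossed by g before y.
The value of g at m decides the wave.
- If g m = s', the constant m is a wave.
- If g m > s', the state m can be kept on the left while the right half rises
  from m to the next zero of g - s', which comes before v.
- If g m < s', let c < y be the next zero of g - s'.  The state c can be kept on
  the right when f c >= s', the left half rising to c from the last zero of
  f - s'.  When f c < s', the graphs of f and g cross between m and c, at a
  level below s', and the crossing point is a constant wave. *)
Lemma exists_violating_wave (R : realType) (a L : R) (f g : R -> R) (x y : R) :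
  0 < L -> (forall u v, `|f u - f v| <= L * `|u - v|) ->
  (forall u v, `|g u - g v| <= L * `|u - v|) ->
  K a x -> K a y -> x <= y -> f x = g y -> ~ connects_up f g (f x) x y ->
  exists p, [/\ standing_wave_pair a f g p, x < p.1, p.2 < y & f p.1 < f x].
Proof.
move=> L0 lf lg Kx Ky xy; set s := f x => gy nconn.
have cf := lipschitz_continuous L0 lf; have cg := lipschitz_continuous L0 lg.
have fx : f x = s by [].
have [|u [v [xu vy fu gv]]] := connects_upPn cf cg xy (lexx _) _ nconn.
  by rewrite -gy.
have KI := K_convex Kx Ky.
have cB (h : R -> R) t : continuous h -> continuous (fun z => h z - t).
  by move=> ch z; apply: continuousB; [exact: ch|exact: cst_continuous].
have cN (h : R -> R) : continuous h -> continuous (fun z => - h z).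
  by move=> ch z; apply: continuousN; exact: ch.
have [s' [s's fus gvs]] : exists s', [/\ s' < s, f u < s' & g v < s'].
  exists ((Num.max (f u) (g v) + s) / 2).
  have : Num.max (f u) (g v) < s by rewrite gt_max fu gv.
  have : f u <= Num.max (f u) (g v) by rewrite le_max lexx.
  have : g v <= Num.max (f u) (g v) by rewrite le_max lexx orbT.
  by split; lra.
have [m [xm mu fm]] : exists m, [/\ x < m, m < u & f m = s'].
  have xu' : x < u.
    rewrite lt_neqAle; case/andP: xu => -> _; rewrite andbT.
    by apply: contraTneq fu => <-; rewrite fx ltxx.
  have [|||z [zu fz zlt]] := @first_zero R (fun t => f t - s') x u _ xu'.
  - exact: cB.
  - by lra.
  - by lra.
  exists z; split; [lra| |lra].
  have zu' : z != u by apply: contraTneq fus => <-; lra.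
  by rewrite lt_neqAle zu'; lra.
have [gm|gm|gm] := ltgtP (g m) s'.
- have my : m < y by lra.
  have [|||c [cy gc clt]] := @first_zero R (fun t => - (g t - s')) m y _ my.
  - by apply: cN; exact: cB.
  - by lra.
  - by lra.
  have cy' : c < y.
    rewrite lt_neqAle; apply/andP.
    by split; [apply: contra_eq_neq gc => ->|]; lra.
  have gc' : g c = s' by lra.
  have [fc|fc|fc] := ltgtP (f c) s'.
  + have mc : m < c by lra.
    have [|||w [wc fgw wlt]] := @first_zero R (fun t => f t - g t) m c _ mc.
    * by move=> z; apply: continuousB; [exact: cf|exact: cg].
    * by lra.
    * by lra.
    have wc' : w < c.
      rewrite lt_neqAle; apply/andP.
      by split; [apply: contra_eq_neq fgw => ->|]; lra.
    have gw := clt w.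
    have fw : f w = g w by lra.
    exists (w, w); split => /=; [|lra|lra|lra].
    by apply: constant_wave => //; apply: KI; lra.
  + have mc : m < c by lra.
    have [|||w [wc fw wlt]] := @last_zero R (fun t => f t - s') m c _ mc.
    * exact: cB.
    * by lra.
    * by lra.
    have wc' : w < c by lra.
    exists (w, c); split => /=; [|lra|lra|lra].
    apply: (wave_rising_left L0 lf cf cg _ _ wc' _ gc' wlt); last lra.
      by apply: KI; lra.
    by apply: KI; lra.
  + exists (c, c); split => /=; [|lra|lra|lra].
    by apply: constant_wave; rewrite ?fc//; apply: KI; lra.
- have mv : m < v by lra.
  have [|||c [cv gc clt]] := @first_zero R (fun t => g t - s') m v _ mv.
  - exact: cB.
  - by lra.
  - by lra.
  have mc : m < c by lra.
  have cy : c < y.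
    have [->//|cv'] := eqVneq c v; last by lra.
    rewrite lt_neqAle vy andbT; apply: contraTneq gvs => ->; lra.
  exists (m, c); split => /=; [|lra|lra|lra].
  apply: (wave_rising_right L0 lg cf cg _ _ mc fm _ clt); last lra.
    by apply: KI; lra.
  by apply: KI; lra.
- exists (m, m); split => /=; [|lra|lra|lra].
  by apply: constant_wave; rewrite ?gm//; apply: KI; lra.
Qed.

(** Both orderings of the states are covered by [exists_violating_wave], applied
to the time-reversed fluxes when q.2 <= q.1. *)
Lemma vv_germ_connected (R : realType) (a L : R) (f g : R -> R) :
  0 < L -> (forall u v, `|f u - f v| <= L * `|u - v|) ->
  (forall u v, `|g u - g v| <= L * `|u - v|) ->
  vv_germ a f g `<=` connected f g.
Proof.
move=> L0 lf lg q [[Kq1 Kq2] qE qS].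
have cf := lipschitz_continuous L0 lf; have cg := lipschitz_continuous L0 lg.
have lN (h : R -> R) : (forall u v, `|h u - h v| <= L * `|u - v|) ->
    forall u v, `|- h u - - h v| <= L * `|u - v|.
  by move=> lh u v; rewrite -opprD normrN.
split => // qle; apply: contrapT => nconn.
  have [p [Sp q1p1 p2q2 fp]] :=
    exists_violating_wave L0 lf lg Kq1 Kq2 qle qE nconn.
  have [pE _ _] := standing_wave_connected cf cg Sp.
  have := qS _ Sp; rewrite /kruzkov_flux -pE -qE.
  rewrite gtr0_sg ?subr_gt0// ltr0_sg ?subr_lt0//; lra.
have qE' : - g q.2 = - f q.1 by rewrite qE.
rewrite qE in nconn.
have [p [Sp q2p1 p2q1 fp]] :=
  exists_violating_wave L0 (lN _ lg) (lN _ lf) Kq2 Kq1 qle qE' nconn.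
rewrite (surjective_pairing p) in Sp.
have Sp' := standing_wave_reverse cf cg Sp.
have [/= pE _ _] := standing_wave_connected cf cg Sp'.
have := qS _ Sp'; rewrite /kruzkov_flux /= -pE -qE.
rewrite ltr0_sg ?subr_lt0// gtr0_sg ?subr_gt0//; lra.
Qed.

(** Every pair compatible with the standing waves is connected, and the standing
waves themselves are connected; so they all are compatible with each other. *)
Lemma vv_germ_maximal_lipschitz (R : realType) (a L : R) (f g : R -> R) :
  0 < L -> (forall u v, `|f u - f v| <= L * `|u - v|) ->
  (forall u v, `|g u - g v| <= L * `|u - v|) ->
  maximal_L1_dissipative (K a) (K a) f g (vv_germ a f g).
Proof.
move=> L0 lf lg.
have cf := lipschitz_continuous L0 lf; have cg := lipschitz_continuous L0 lg.
have Gc := vv_germ_connected L0 lf lg.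
split; first split.
- by move=> q [].
- by move=> q [].
- by move=> p q /Gc Cp /Gc Cq; exact: connected_dissipative.
move=> q Kq qE qG; split => // p Sp; apply: qG.
have Cp := standing_wave_connected cf cg Sp.
case: (Sp) => Kp _; case: (Cp) => pE _ _; split => // r Sr.
by apply: connected_dissipative => //; exact: standing_wave_connected Sr.
Qed.

(** * Fluxes defined on the segment K *)

Definition C1_segment (R : realType) (a : R) (phi dphi : R -> R) : Prop :=
  [/\ {within K a, continuous phi}, {within K a, continuous dphi}
    & forall x, - a < x < a -> is_derive x 1 phi (dphi x)].

Definition clamp (R : realType) (a x : R) : R := Num.max (- a) (Num.min x a).

Lemma clamp_id (R : realType) (a x : R) : K a x -> clamp a x = x.
Proof.
by rewrite /K /clamp/= in_itv/= => /andP[ax xa]; rewrite min_l// max_r.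
Qed.

Lemma clamp_K (R : realType) (a x : R) : 0 < a -> K a (clamp a x).
Proof.
move=> a0; rewrite /K /clamp/= in_itv/= le_max lexx/= ge_max ge_min lexx orbT.
by rewrite andbT; lra.
Qed.

Lemma clamp_lipschitz (R : realType) (a x y : R) : 0 < a ->
  `|clamp a x - clamp a y| <= `|x - y|.
Proof.
move=> a0.
wlog : x y / x <= y => [wl|xy].
  have [xy|/ltW yx] := leP x y; first exact: wl.
  by rewrite distrC (distrC x); exact: wl.
rewrite (ler0_norm (x := x - y)) ?subr_le0// /clamp.
by rewrite ler_norml !maxEle !minEle; repeat case: ifPn; rewrite -?ltNge; lra.
Qed.

Lemma continuous_clamp (R : realType) (a : R) (h : R -> R) : 0 < a ->
  {within K a, continuous h} -> continuous (h \o clamp a).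
Proof.
move=> a0 /subspace_continuousP ch x.
apply/cvgrPdist_lt => e e0.
have /cvgrPdist_lt/(_ _ e0) := ch (clamp a x) (clamp_K x a0).
rewrite near_withinE => /nbhs_ballP[d /= d0 dP].
apply/nbhs_ballP; exists d => //= y; rewrite /ball/= => xy.
apply: dP; last exact: clamp_K.
by apply: le_lt_trans xy; exact: clamp_lipschitz.
Qed.

Lemma standing_wave_pair_congr (R : realType) (a : R) (f f' g g' : R -> R)
    (p : R * R) :
  {in K a, f =1 f'} -> {in K a, g =1 g'} ->
  standing_wave_pair a f g p -> standing_wave_pair a f' g' p.
Proof.
move=> ff gg [Kp [s [W [[cW KW] dWm dWp limm limp]]]].
split => //; exists s, W.
have <- : (fun x => f (W x) - s) = (fun x => f' (W x) - s).
  by apply/funext => x; rewrite ff// inE.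
have <- : (fun x => g (W x) - s) = (fun x => g' (W x) - s).
  by apply/funext => x; rewrite gg// inE.
by [].
Qed.

(** The germ only sees the fluxes on K: precomposing them with the projection
onto K makes them Lipschitz on the whole line. *)
Lemma vv_germ_maximal (R : realType) (a L : R) (f g : R -> R) :
  0 < a -> 0 < L ->
  (forall u v, K a u -> K a v -> `|f u - f v| <= L * `|u - v|) ->
  (forall u v, K a u -> K a v -> `|g u - g v| <= L * `|u - v|) ->
  maximal_L1_dissipative (K a) (K a) f g (vv_germ a f g).
Proof.
move=> a0 L0 lf lg.
have lC (h : R -> R) :
    (forall u v, K a u -> K a v -> `|h u - h v| <= L * `|u - v|) ->
    forall u v, `|(h \o clamp a) u - (h \o clamp a) v| <= L * `|u - v|.
  move=> lh u v; apply: le_trans (lh _ _ (clamp_K u a0) (clamp_K v a0)) _.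
  by rewrite ler_wpM2l ?(ltW L0)// clamp_lipschitz.
have cE (h : R -> R) u : K a u -> (h \o clamp a) u = h u.
  by move=> Ku; rewrite /= clamp_id.
have [[GK GRH GD] Gmax] := vv_germ_maximal_lipschitz a L0 (lC _ lf) (lC _ lg).
have kE (h : R -> R) u v : K a u -> K a v ->
    kruzkov_flux (h \o clamp a) u v = kruzkov_flux h u v.
  by move=> Ku Kv; rewrite /kruzkov_flux !cE.
have -> : vv_germ a f g = vv_germ a (f \o clamp a) (g \o clamp a).
  apply/seteqP; split => q [[Kq1 Kq2] qE qS]; split => //.
  - by rewrite !cE.
  - move=> p Sp; case: (Sp) => -[Kp1 Kp2] _; rewrite !kE//; apply: qS.
    by apply: standing_wave_pair_congr Sp => u; rewrite inE; exact: cE.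
  - by move: qE; rewrite !cE.
  - move=> p Sp; case: (Sp) => -[Kp1 Kp2] _; rewrite -kE// -(kE f)//; apply: qS.
    by apply: standing_wave_pair_congr Sp => u; rewrite inE => Ku; rewrite cE.
split; first split => //.
- by move=> r Gr; have := GRH _ Gr; have [K1 K2] := GK _ Gr; rewrite !cE.
- move=> r s Gr Gs; have := GD _ _ Gr Gs.
  by have [K1 K2] := GK _ Gr; have [K3 K4] := GK _ Gs; rewrite !kE.
- move=> r [K1 K2] rE rD; apply: Gmax => //; first by rewrite !cE.
  by move=> s Gs; have [K3 K4] := GK _ Gs; rewrite !kE//; exact: rD.
Qed.

(** The Kruzhkov flux of phi = hat \o P at (x, y) is that of hat at (P x, P y):
the signs of x - y and P x - P y agree unless P x = P y, and then both fluxes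
vanish. *)
Lemma maximal_L1_dissipative_image (R : realType) (I : set R)
    (phim phip hatm hatp Pm Pp : R -> R) (G : set (R * R)) :
  (forall x y, I x -> I y -> x <= y -> Pm x <= Pm y) ->
  (forall x y, I x -> I y -> x <= y -> Pp x <= Pp y) ->
  (forall x, I x -> phim x = hatm (Pm x)) ->
  (forall x, I x -> phip x = hatp (Pp x)) ->
  maximal_L1_dissipative I I phim phip G ->
  maximal_L1_dissipative (Pm @` I) (Pp @` I) hatm hatp
    [set (Pm p.1, Pp p.2) | p in G].
Proof.
move=> ndm ndp hm hp [[GI GRH GD] Gmax].
have kE (P phi hat : R -> R) x y :
    (forall x y, I x -> I y -> x <= y -> P x <= P y) ->
    (forall x, I x -> phi x = hat (P x)) -> I x -> I y ->
    kruzkov_flux hat (P x) (P y) = kruzkov_flux phi x y.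
  move=> nd h Ix Iy; rewrite /kruzkov_flux !h//.
  have [->|Pxy] := eqVneq (P x) (P y); first by rewrite !subrr !mulr0.
  congr (_ * _); case: (ltgtP x y) => xy.
  - rewrite !ltr0_sg// subr_lt0// lt_neqAle Pxy.
    by apply: nd => //; exact: ltW.
  - rewrite !gtr0_sg// subr_gt0// lt_neqAle eq_sym Pxy.
    by apply: nd => //; exact: ltW.
  - by move: Pxy; rewrite xy eqxx.
split; first split.
- move=> _ [p Gp <-]; have [I1 I2] := GI _ Gp.
  by split; [exists p.1|exists p.2].
- move=> _ [p Gp <-] /=; have [I1 I2] := GI _ Gp.
  by rewrite -hm// -hp//; exact: GRH.
- move=> _ _ [p Gp <-] [q Gq <-] /=.
  have [I1 I2] := GI _ Gp; have [I3 I4] := GI _ Gq.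
  by rewrite (kE Pm phim hatm)// (kE Pp phip hatp)//; exact: GD.
- move=> [_ _] [/= [x Ix <-] [y Iy <-]] xyE xyD.
  exists (x, y) => //; apply: Gmax => //=; first by rewrite hm// hp.
  move=> s Gs; have [I3 I4] := GI _ Gs.
  have := xyD (Pm s.1, Pp s.2) => /=.
  rewrite (kE Pm phim hatm)// (kE Pp phip hatp)//; apply; by exists s.
Qed.

Lemma C1_segment_lipschitz (R : realType) (a : R) (phi dphi : R -> R) :
  0 < a -> C1_segment a phi dphi ->
  exists2 L, 0 < L &
    forall u v, K a u -> K a v -> `|phi u - phi v| <= L * `|u - v|.
Proof.
move=> a0 [cphi cdphi dP].
have aa : - a <= a by lra.
have [|c _ cmax] := @EVT_max _ (fun x => `|(dphi \o clamp a) x|) _ _ aa.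
  apply: continuous_subspaceT => x.
  by apply: cvg_norm; exact: continuous_clamp.
pose L := 1 + `|(dphi \o clamp a) c|.
exists L; first by rewrite /L ltr_pwDl.
move=> u v; wlog : u v / u < v => [wl|uv] Ku Kv.
  have [uv|vu|->] := ltgtP u v; last by rewrite !subrr !normr0 mulr0.
    exact: wl.
  by rewrite distrC (distrC u); exact: wl.
have Ku' : - a <= u <= a by move: Ku; rewrite /K/= in_itv.
have Kv' : - a <= v <= a by move: Kv; rewrite /K/= in_itv.
have [||w wuv] := @MVT _ phi dphi _ _ uv.
- by move=> x; rewrite in_itv/= => xuv; apply: dP; lra.
- by apply: continuous_subspaceW cphi => x; rewrite /K/= !in_itv/=; lra.
move: wuv; rewrite in_itv/= => wuv.
rewrite distrC (distrC u) => ->; rewrite normrM ler_wpM2r//.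
have Kw : w \in `[- a, a] by rewrite in_itv/=; lra.
by have := cmax _ Kw; rewrite /= clamp_id// /L; lra.
Qed.

(** * Boundary quotient and reduced flux *)

(** Starting the integral at - a - 1 rather than at - a makes the primitive T
differentiable at the end point - a too. *)
Lemma quotient_primitive (R : realType) (a : R) (phi dphi : R -> R) :
  0 < a -> C1_segment a phi dphi ->
  exists2 T : R -> R, forall x, K a x -> is_derive x 1 T (dphi x ^+ 2) &
    forall x, K a x -> quotient a phi x = T x - T (- a).
Proof.
move=> a0 [cphi cdphi dP].
pose k x := ((dphi \o clamp a) x) ^+ 2.
have ck : continuous k.
  move=> x; apply: (@continuous_comp _ _ _ (dphi \o clamp a) (fun z => z ^+ 2)).
    exact: continuous_clamp.
  exact: exprn_continuous.
have ik u v : (@lebesgue_measure R).-integrable `[u, v] (EFin \o k).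
  apply: continuous_compact_integrable; first exact: segment_compact.
  exact: continuous_subspaceT.
exists (fun x => \int[lebesgue_measure]_(t in `[- a - 1, x]) k t).
  move=> x Kx; have Kx' : - a <= x <= a by move: Kx; rewrite /K/= in_itv.
  rewrite -[in dphi x](clamp_id Kx).
  by apply: (@is_derive_integral _ k _ _ (x + 1)); [lra|lra|];
    move=> y _; exact: ck.
move=> x Kx; have Kx' : - a <= x <= a by move: Kx; rewrite /K/= in_itv.
rewrite (@Rintegral_itvB _ k (BLeft (- a - 1)) (BRight x) (- a)) ?bnd_simp;
  [|exact: ik|lra|lra].
rewrite /quotient /Rintegral; congr fine.
have eqk t : t \in `]- a, x[ -> `|phi^`()%classic t| ^+ 2 = k t.
  rewrite in_itv/= => tax; have tK : K a t by rewrite /K/= in_itv/=; lra.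
  have ta : - a < t < a by lra.
  have dphit := dP _ ta.
  by rewrite derive1E derive_val /k/= clamp_id// real_normK// num_real.
have mk : measurable_fun `]- a, x[ k.
  by apply: measurable_funTS; exact: continuous_measurable_fun.
have mphi : measurable_fun `]- a, x[ (fun t => `|phi^`()%classic t| ^+ 2).
  by apply: eq_measurable_fun mk => t; rewrite inE/= => /eqk ->.
rewrite (@eq_integral_itv_bounded _ _ _ k)// integral_itv_obnd_cbnd//.
by apply/measurable_EFinP/measurable_funTS; exact: continuous_measurable_fun.
Qed.

(** Young's inequality |phi'| <= e + |phi'|^2 / (4 e), integrated from x to y:
the derivative of e z + T z / (4 e) - s phi z, for s = 1 or -1, is the square
(2 e - s phi' z)^2 divided by 4 e. *)
Lemma quotient_control (R : realType) (a : R) (phi dphi : R -> R) (x y e : R) :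
  0 < a -> C1_segment a phi dphi -> K a x -> K a y -> x <= y -> 0 < e ->
  quotient a phi x <= quotient a phi y /\
  `|phi y - phi x| <= e * (y - x) +
     (4 * e)^-1 * (quotient a phi y - quotient a phi x).
Proof.
move=> a0 C1 Kx Ky xy e0; have [cphi _ dP] := C1.
have [T dT qT] := quotient_primitive a0 C1.
have Kx' : - a <= x <= a by move: Kx; rewrite /K/= in_itv.
have Ky' : - a <= y <= a by move: Ky; rewrite /K/= in_itv.
have inK z : z \in `]- a, a[ -> K a z.
  by rewrite /K/= !in_itv/=; lra.
have cT : {within K a, continuous T}.
  apply: derivable_within_continuous => z zK.
  by have := dT _ zK => dTz; exact: ex_derive.
split.
  have TT : T x <= T y.
    apply: (@ge0_is_derive_le _ T (fun z => dphi z ^+ 2) (- a) a); try lra.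
    - exact: cT.
    - by move=> z za; apply: dT; apply: inK; rewrite in_itv.
    - by move=> z; exact: sqr_ge0.
  by rewrite (qT _ Kx) (qT _ Ky); lra.
have main (s : R) : s ^+ 2 = 1 ->
    s * (phi y - phi x) <= e * (y - x) + (4 * e)^-1 * (T y - T x).
  move=> s1.
  pose F z := e * z + (4 * e)^-1 * T z - s * phi z.
  suff : F x <= F y by rewrite /F; lra.
  apply: (@ge0_is_derive_le _ F
    (fun z => (4 * e)^-1 * (2 * e - s * dphi z) ^+ 2) (- a) a); try lra.
  - apply/subspace_continuousP => z zK.
    move/subspace_continuousP : cT => /(_ _ zK) cTz.
    move/subspace_continuousP : cphi => /(_ _ zK) cphiz.
    apply: cvgB; last by apply: cvgM => //; exact: cvg_cst.
    apply: cvgD; last by apply: cvgM => //; exact: cvg_cst.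
    by apply: cvgM; [exact: cvg_cst|apply: cvg_within_filter; exact: cvg_id].
  - move=> z za; have zK : z \in `]- a, a[ by rewrite in_itv.
    have dTz := dT _ (inK _ zK).
    have dphiz := dP _ za.
    rewrite /F; apply: is_derive_eq.
    rewrite /GRing.scale/=.
    have -> : (2 * e - s * dphi z) ^+ 2 =
      4 * e * e - 4 * e * (s * dphi z) + s ^+ 2 * dphi z ^+ 2 by ring.
    by rewrite s1; field; rewrite gt_eqF.
  - by move=> z; rewrite mulr_ge0 ?sqr_ge0// invr_ge0; lra.
rewrite (qT _ Kx) (qT _ Ky).
have -> : T y - T (- a) - (T x - T (- a)) = T y - T x by lra.
have := main 1; have := main (-1); rewrite sqrrN expr1n ler_norml.
by move=> /(_ erefl) H1 /(_ erefl) H2; lra.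
Qed.

Lemma quotient_nondecreasing (R : realType) (a : R) (phi dphi : R -> R)
    (x y : R) :
  0 < a -> C1_segment a phi dphi -> K a x -> K a y -> x <= y ->
  quotient a phi x <= quotient a phi y.
Proof.
by move=> a0 C1 Kx Ky xy; have [] := quotient_control a0 C1 Kx Ky xy ltr01.
Qed.

Lemma flux_quotient_modulus (R : realType) (a : R) (phi dphi : R -> R)
    (x y e : R) :
  0 < a -> C1_segment a phi dphi -> K a x -> K a y -> 0 < e ->
  `|phi y - phi x| <= e * (2 * a) +
     (4 * e)^-1 * `|quotient a phi y - quotient a phi x|.
Proof.
move=> a0 C1; wlog : x y / x <= y => [wl Kx Ky e0|xy Kx Ky e0].
  have [xy|/ltW yx] := leP x y; first exact: wl.
  by rewrite distrC (distrC (quotient a phi y)); exact: wl.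
have [q1 q2] := quotient_control a0 C1 Kx Ky xy e0.
apply: le_trans q2 _; rewrite ger0_norm ?subr_ge0// lerD2r.
rewrite (ler_wpM2l (ltW e0))//.
have /andP[x1 _] : - a <= x <= a by move: Kx; rewrite /K/= in_itv.
have /andP[_ y1] : - a <= y <= a by move: Ky; rewrite /K/= in_itv.
by have := lerB y1 x1; lra.
Qed.

(** The factor phi \o lam, for any section lam of the quotient, is the reduced
flux; by [flux_quotient_modulus] the choice of the section is irrelevant and the
factor is continuous. *)
Lemma reduced_fluxP (R : realType) (a : R) (phi dphi : R -> R) :
  0 < a -> C1_segment a phi dphi ->
  is_reduced_flux a phi (reduced_flux a phi).
Proof.
move=> a0 C1; apply: xgetPex.
pose lam r := xget 0 [set x | K a x /\ quotient a phi x = r].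
have lamP x : K a x -> K a (lam (quotient a phi x)) /\
    quotient a phi (lam (quotient a phi x)) = quotient a phi x.
  move=> Kx.
  by apply: (xgetI 0 (P := [set z | K a z /\ _ = _]) (x := x)); split.
have phiE x y : K a x -> K a y ->
    quotient a phi x = quotient a phi y -> phi x = phi y.
  move=> Kx Ky qxy; apply/eqP; rewrite -subr_eq0 -normr_le0.
  apply/ler_addgt0Pr => e e0; rewrite add0r.
  have e0' : 0 < e / (2 * a) by rewrite divr_gt0//; lra.
  have := flux_quotient_modulus a0 C1 Ky Kx e0'.
  rewrite qxy subrr normr0 mulr0 addr0 divfK// gt_eqF//; lra.
exists (fun r => phi (lam r)); split.
  apply/subspace_continuousP => r [x Kx <-].
  have [Kl ql] := lamP _ Kx.
  apply/cvgrPdist_le => e e0; rewrite near_withinE.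
  (* the value for which the two terms of the modulus balance, at e / 2 each *)
  pose d := e / (4 * a).
  have d0 : 0 < d by rewrite divr_gt0//; lra.
  apply/nbhs_ballP; exists (2 * d * e); first by rewrite /= mulr_gt0//; lra.
  move=> t + [y Ky qt]; rewrite -qt /ball/= => xy; have [Kl' ql'] := lamP _ Ky.
  apply: le_trans (flux_quotient_modulus a0 C1 Kl' Kl d0) _.
  rewrite ql ql'.
  have e1 : (4 * d)^-1 * (2 * d * e) = e / 2 by field; rewrite gt_eqF.
  have e2 : d * (2 * a) = e / 2 by rewrite /d; field; rewrite gt_eqF.
  rewrite [leRHS](splitr e) -[X in _ <= X + _]e2 -e1 lerD2l.
  by apply: ler_wpM2l (ltW xy); rewrite invr_ge0 mulr_ge0// ltW.
by move=> x Kx; have [Kl ql] := lamP _ Kx; exact: phiE.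
Qed.

(** * Traces of the fluxes on the interface *)

Lemma closure_setM (T1 T2 : topologicalType) (A : set T1) (B : set T2) x y :
  closure A x -> closure B y -> closure (A `*` B) (x, y).
Proof.
move=> Ax By C [[P Q] [/= nP nQ] PQ].
have [u [Au Pu]] := Ax _ nP; have [v [Bv Qv]] := By _ nQ.
by exists (u, v); split => //; exact: PQ.
Qed.

Lemma closure_open_segment (R : realType) (a x : R) : 0 < a ->
  K a x -> closure `]- a, a[ x.
Proof.
move=> a0; rewrite /K/= in_itv/= => /andP[ax xa] B /nbhs_ballP[d /= d0 dB].
have [t [t0 t1 td]] : exists t : R, [/\ 0 < t, t < 1 & a * t < d].
  exists (d / (a + d)); have ad : 0 < a + d by exact: addr_gt0.
  split; first exact: divr_gt0.
    by rewrite ltr_pdivrMr// mul1r; lra.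
  by rewrite mulrA ltr_pdivrMr// mulrDr; have := mulr_gt0 d0 d0; lra.
exists (x * (1 - t)); split.
  rewrite /= in_itv/=.
  have H1 : 0 <= (a - x) * (1 - t) by apply: mulr_ge0; lra.
  have H2 : 0 <= (a + x) * (1 - t) by apply: mulr_ge0; lra.
  have H3 : 0 < a * t by exact: mulr_gt0.
  by lra.
apply: dB; rewrite /ball/= (_ : x - _ = x * t); last by ring.
apply: le_lt_trans td; rewrite normrM (gtr0_norm t0).
by apply: ler_wpM2r; [exact: ltW|rewrite ler_norml ax].
Qed.

Lemma closure_ray (R : realType) (V : normedModType R) (A : set V) (x v : V)
    (s : R) :
  s != 0 -> (forall t : R, 0 < t * s -> A (t *: v + x)) -> closure A x.
Proof.
move=> s0 Av B nB.
have : (fun t : R => t *: v + x) @ 0 --> x.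
  rewrite -[X in _ --> X]add0r -(scale0r v).
  by apply: cvgD; [apply: cvgZr_tmp; exact: cvg_id|exact: cvg_cst].
move=> /(_ _ nB) /nbhs_ballP[d /= d0 dB].
exists ((d / 2 * Num.sg s) *: v + x); split.
  apply: Av; rewrite (_ : _ * s = d / 2 * `|s|); last by rewrite normrEsg mulrA.
  by rewrite mulr_gt0 ?normr_gt0// divr_gt0.
apply: dB; rewrite /ball/= sub0r normrN normrM normr_sg s0 mulr1 gtr0_norm; lra.
Qed.

Lemma is_derive_slice (R : realType) (V : normedModType R) (F : V * R -> R)
    (x : V) (y l : R) :
  is_derive (x, y) (0, 1) F l -> is_derive y 1 (fun t => F (x, t)) l.
Proof.
move=> [dF Fl].
have E : (fun h : R => h^-1 *: ((F \o shift (x, y)) (h *: (0, 1)) - F (x, y))) =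
  (fun h : R => h^-1 *:
    (((fun t => F (x, t)) \o shift y) (h *: (1 : R)) - F (x, y))).
  apply/funext => h /=; congr (_ *: (F _ - _)).
  by congr pair; rewrite /= scaler0 add0r.
apply: DeriveDef.
  by rewrite /derivable; move: dF; rewrite /derivable E.
by move: Fl; rewrite /derive E.
Qed.

Lemma increment_slice (R : realType) (V : normedModType R) (a d : R)
    (F dF : V * R -> R) (x : V) (y t : R) :
  (forall u, - a < u < a -> is_derive (x, u) (0, 1) F (dF (x, u))) ->
  - a < y < a -> - a < t < a -> t != y -> `|y - t| < d ->
  exists2 u, - a < u < a /\ `|y - u| < d &
    F (x, t) - F (x, y) = dF (x, u) * (t - y).
Proof.
move=> dFx ya ta; rewrite ltr_norml.
have mvt b c : - a < b < a -> - a < c < a -> b < c -> exists2 u, b < u < c &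
    F (x, c) - F (x, b) = dF (x, u) * (c - b).
  move=> /andP[ab _] /andP[_ ca] bc.
  have dslice u : b <= u <= c ->
      is_derive u 1 (fun t => F (x, t)) (dF (x, u)).
    by move=> ubc; apply/is_derive_slice/dFx; lra.
  have [||u ubc uE] :=
    @MVT _ (fun t => F (x, t)) (fun t => dF (x, t)) _ _ bc.
  - by move=> u; rewrite in_itv/= => ubc; apply: dslice; lra.
  - apply: derivable_within_continuous => u; rewrite in_itv/= => ubc.
    by have du := dslice _ ubc; exact: ex_derive.
  by exists u => //; move: ubc; rewrite in_itv.
case: (ltgtP t y) => // ty _ ytd.
  have [u u1 u2] := mvt _ _ ta ya ty.
  by exists u; [split; [|rewrite ltr_norml]; lra|lra].
have [u u1 u2] := mvt _ _ ya ta ty.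
by exists u; [split; [|rewrite ltr_norml]; lra|lra].
Qed.

Lemma within_continuous_ball (R : realType) (V W : normedModType R)
    (A : set V) (F : V -> W) z e :
  {within A, continuous F} -> A z -> 0 < e ->
  exists2 d, 0 < d & forall w, A w -> ball z d w -> `|F z - F w| < e.
Proof.
move=> /subspace_continuousP cF Az e0; have /cvgrPdist_lt/(_ _ e0) := cF _ Az.
rewrite near_withinE => /nbhs_ballP[d /= d0 dP].
by exists d => // w Aw zw; exact: dP.
Qed.

(** The derivative in the last variable survives the passage to a boundary point
x0: at points x of Omega near x0 the mean value theorem expresses the increment
of F (x, .) by a value of dF close to dF (x0, y), and F (x, .) tends to
F (x0, .) as x tends to x0. *)
Lemma C1_segment_trace (R : realType) (V : normedModType R) (Omega : set V)
    (a : R) (F dF : V * R -> R) (x0 : V) :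
  0 < a -> closure Omega x0 ->
  {within closure (Omega `*` `]- a, a[), continuous F} ->
  {within closure (Omega `*` `]- a, a[), continuous dF} ->
  (forall z, (Omega `*` `]- a, a[) z -> is_derive z (0, 1) F (dF z)) ->
  C1_segment a (fun t => F (x0, t)) (fun t => dF (x0, t)).
Proof.
move=> a0 x0O cF cdF dFP; set U := Omega `*` `]- a, a[.
have clU t : K a t -> closure U (x0, t).
  by move=> Kt; apply: closure_setM => //; exact: closure_open_segment.
have slice (G : V * R -> R) : {within closure U, continuous G} ->
    {within K a, continuous (fun t => G (x0, t))}.
  move=> cG; apply/subspace_continuousP => t Kt; apply/cvgrPdist_lt => e e0.
  have [d d0 dP] := within_continuous_ball cG (clU _ Kt) e0.
  rewrite near_withinE; apply/nbhs_ballP; exists d => //= u tu Ku.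
  by apply: dP; [exact: clU|split => //=; exact: ballxx].
split; [exact: slice|exact: slice|].
move=> y ya; have Ky : K a y by rewrite /K/= in_itv/=; lra.
apply/is_derive_has_derivative_within/has_derivative_withinP => e e0.
have e2 : 0 < e / 2 by lra.
have [d d0 dP] := within_continuous_ball cdF (clU _ Ky) e2.
exists (Num.min d (Num.min (y + a) (a - y))).
  by rewrite !lt_min d0/=; lra.
move=> t _ ty; rewrite !lt_min => /and3P[ytd yt1 yt2].
have ta : - a < t < a.
  by move: yt1 yt2; rewrite !ltr_norml; lra.
have Kt : K a t by rewrite /K/= in_itv/=; lra.
have ty0 : 0 < `|t - y| by rewrite normr_gt0 subr_eq0.
have main : `|F (x0, t) - F (x0, y) - dF (x0, y) * (t - y)| <= e / 2 * `|t - y|.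
  apply/ler_addgt0Pr => r r0.
  have r2 : 0 < r / 2 by lra.
  have [d1 d10 dP1] := within_continuous_ball cF (clU _ Ky) r2.
  have [d2 d20 dP2] := within_continuous_ball cF (clU _ Kt) r2.
  have m0 : 0 < Num.min d (Num.min d1 d2) by rewrite !lt_min d0 d10.
  have [x [Ox bx]] := x0O _ (nbhsx_ballx x0 _ m0).
  have [bd b1 b2] : [/\ ball x0 d x, ball x0 d1 x & ball x0 d2 x].
    by split; apply: le_ball bx; rewrite !ge_min lexx ?orbT.
  have xU u : - a < u < a -> U (x, u).
    by move=> ua; split => //=; rewrite in_itv.
  have Fy : `|F (x0, y) - F (x, y)| < r / 2.
    by apply: dP1; [exact/subset_closure/xU|split => //=; exact: ballxx].
  have Ft : `|F (x0, t) - F (x, t)| < r / 2.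
    by apply: dP2; [exact/subset_closure/xU|split => //=; exact: ballxx].
  have [u [ua yud] uE] := increment_slice (fun u ua => dFP _ (xU u ua))
    ya ta ty ytd.
  have dFu : `|dF (x0, y) - dF (x, u)| < e / 2.
    by apply: dP; [exact/subset_closure/xU|split].
  have -> : F (x0, t) - F (x0, y) - dF (x0, y) * (t - y) =
      (F (x0, t) - F (x, t)) - (F (x0, y) - F (x, y)) -
      (dF (x0, y) - dF (x, u)) * (t - y).
    by move: uE; lra.
  apply: le_trans (ler_normB _ _) _; rewrite normrM.
  have H := ler_wpM2r (ltW ty0) (ltW dFu).
  have H2 := ler_normB (F (x0, t) - F (x, t)) (F (x0, y) - F (x, y)).
  by lra.
rewrite (_ : _ - _ =
  - ((F (x0, t) - F (x0, y) - dF (x0, y) * (t - y)) / (t - y))).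
  rewrite normrN normrM normfV ltr_pdivrMr//; apply: le_lt_trans main _.
  by rewrite ltr_pM2r//; lra.
by field; rewrite subr_eq0.
Qed.

Lemma flux_C2_trace (R : realType) (n : nat) (Omega : set 'rV[R]_n.+1) (a : R)
    (f : 'rV[R]_n.+1 * R -> 'rV[R]_n.+1) (x' : 'rV[R]_n) :
  0 < a -> closure Omega (interface_point x') -> flux_C2 Omega a f ->
  exists dphi, C1_segment a (normal_flux f x') dphi.
Proof.
move=> a0 clO [cf /(_ None)[df [dfP [cdf _]]]].
exists (fun t => df (interface_point x', t) 0 0).
have coord (h : 'rV[R]_n.+1 * R -> 'rV[R]_n.+1) A :
    {within A, continuous h} -> {within A, continuous (fun z => h z 0 0)}.
  move=> /subspace_continuousP ch; apply/subspace_continuousP => z Az.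
  apply: (@cvg_comp _ _ _ h (fun M : 'rV[R]_n.+1 => M 0 0) _ _ _ (ch _ Az)).
  exact: coord_continuous.
apply: (@C1_segment_trace _ _ Omega a
  (fun z => f z 0 0) (fun z => df z 0 0)) => //.
- exact: coord.
- exact: coord.
- move=> z Uz; have [df1 df2] := dfP z Uz.
  have dc := iffLR (@derivable_mxP _ _ _ _ f z (coord_dir R None)) df1.
  apply: DeriveDef; first exact: dc.
  by rewrite -df2 derive_mx// mxE.
Qed.

Lemma closure_Omega_minus (R : realType) (n : nat) (x' : 'rV[R]_n) :
  closure (@Omega_minus R n) (interface_point x').
Proof.
apply: (@closure_ray _ _ _ _ (delta_mx 0 0) (-1)).
  by rewrite oppr_eq0 oner_eq0.
move=> t; rewrite mulrN1 oppr_gt0 /Omega_minus/= => t0.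
rewrite /interface_point !mxE eqxx mulr1.
by case: splitP => // j _; rewrite mxE addr0.
Qed.

Lemma closure_Omega_plus (R : realType) (n : nat) (x' : 'rV[R]_n) :
  closure (@Omega_plus R n) (interface_point x').
Proof.
apply: (@closure_ray _ _ _ _ (delta_mx 0 0) 1); first exact: oner_neq0.
move=> t; rewrite mulr1 /Omega_plus/= => t0.
rewrite /interface_point !mxE eqxx mulr1.
by case: splitP => // j _; rewrite mxE addr0.
Qed.

Unset Implicit Arguments.

Theorem proposition3p6 (R : realType) (n : nat) (a : R)
    (f g : 'rV[R]_n.+1 * R -> 'rV[R]_n.+1)
    (a_gt0 : 0 < a)
    (f_C2 : flux_C2 (@Omega_minus R n) a f)
    (g_C2 : flux_C2 (@Omega_plus R n) a g)
    (f_pm : forall x, closure (@Omega_minus R n) x ->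
              f (x, - a) = 0 /\ f (x, a) = 0)
    (g_pm : forall x, closure (@Omega_plus R n) x ->
              g (x, - a) = 0 /\ g (x, a) = 0)
    (x' : 'rV[R]_n) :
  let Phim := normal_flux f x' in
  let Phip := normal_flux g x' in
  let Phihatm := reduced_flux a Phim in
  let Phihatp := reduced_flux a Phip in
  let Gvv := projected_vv_germ a Phim Phip in
  [/\ maximal_L1_dissipative (quotient a Phim @` K a) (quotient a Phip @` K a)
        Phihatm Phihatp Gvv,
      forall r, Gvv r -> Phihatm r.1 = Phihatp r.2
    & forall r s, Gvv r -> Gvv s ->
        kruzkov_flux Phihatp r.2 s.2 - kruzkov_flux Phihatm r.1 s.1 <= 0].
Proof.
move=> Phim Phip Phihatm Phihatp Gvv.
have [dPhim C1m] := flux_C2_trace a_gt0 (@closure_Omega_minus R n x') f_C2.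
have [dPhip C1p] := flux_C2_trace a_gt0 (@closure_Omega_plus R n x') g_C2.
have [Lm Lm0 lipm] := C1_segment_lipschitz a_gt0 C1m.
have [Lp Lp0 lipp] := C1_segment_lipschitz a_gt0 C1p.
have L0 : 0 < Lm + Lp by exact: addr_gt0.
have Gmax : maximal_L1_dissipative (K a) (K a) Phim Phip (vv_germ a Phim Phip).
  apply: (vv_germ_maximal a_gt0 L0) => u v Ku Kv.
    by apply: le_trans (lipm _ _ Ku Kv) _; rewrite ler_wpM2r// lerDl ltW.
  by apply: le_trans (lipp _ _ Ku Kv) _; rewrite ler_wpM2r// lerDr ltW.
have [_ Phim_hat] := reduced_fluxP a_gt0 C1m.
have [_ Phip_hat] := reduced_fluxP a_gt0 C1p.
have main : maximal_L1_dissipative (quotient a Phim @` K a)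
    (quotient a Phip @` K a) Phihatm Phihatp Gvv.
  apply: (maximal_L1_dissipative_image _ _ Phim_hat Phip_hat Gmax).
    by move=> x y; exact: (quotient_nondecreasing a_gt0 C1m).
  by move=> x y; exact: (quotient_nondecreasing a_gt0 C1p).
by split => //; case: main => -[].
Qed.
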